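(* Let $M$ be an arbitrary smooth manifold of dimension $n>2$, and let $g_1$ and $g_2$ be two pseudo-Riemannian metrics on $M$ related by $g_1=p^2g_2$ for a positive smooth function $p$ on $M$. For a pseudo-Riemannian metric $g$ on $M$ and a smooth scalar function $\phi$ on $M$, set $$\mathcal{Q}(g)\phi=(\mathcal{L}_g)^2\phi+T_j\left[\left(-\frac{4}{n-2}R^{ij}+\frac{n^2-4n+8}{2(n-1)(n-2)}g^{ij}R\right)\frac{\partial}{\partial x^i}\phi\right]+\left[\frac{n-4}{4(n-1)}(\mathcal{L}_gR)-\frac{n-4}{(n-2)^2}R^{ij}R_{ij}+\frac{(n-4)(n^3-4n^2+16n-16)}{16(n-1)^2(n-2)^2}R^2\right]\phi ,$$ where $\mathcal{L}_g$, $T_j$, $R_{ij}$, $R$ are the Laplace--Beltrami operator, covariant derivative, Ricci tensor and scalar curvature of $g$ (with the sign conventions given in the context). Then for all smooth scalar functions $\phi$ on $M$, $$p^{(n+4)/2}\,\mathcal{Q}(g_1)\phi=\mathcal{Q}(g_2)\bigl(p^{(n-4)/2}\phi\bigr).$$ Moreover, when $n=4$, one has for every pseudo-Riemannian metric $g$ on $M$ $$\mathcal{Q}(g)\phi=(\mathcal{L}_g)^2\phi-2T_j\left[\left(R^{ij}-\frac13 g^{ij}R\right)\frac{\partial}{\partial x^i}\phi\right],$$ and the kernel of this operator is independent of the metric within the conformal class, i.e. $\ker\mathcal{Q}(g_1)=\ker\mathcal{Q}(g_2)$ as subspaces of the smooth functions on $M$; this kernel is also invariant under the ordinary pointwise action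 on functions of the conformal group of $(M,g_1)$ (equivalently, of $(M,g_2)$).
   Context: Notation, for a pseudo-Riemannian metric $g$ (arbitrary signature) on an $n$-dimensional smooth manifold $M$ with local coordinates $x^1,\dots,x^n$ and Levi-Civita connection $\nabla$: $T_i=\nabla_{\partial/\partial x^i}$; $g_{ij}$ are the components of $g$ and $g^{ij}$ those of the inverse metric; indices are raised and lowered with $g$ and repeated indices are summed. $\mathcal{L}_g\phi=g^{ij}T_iT_j\phi$ is the Laplace--Beltrami operator (divergence of the gradient). $T_j[V^j]$ denotes the divergence of the vector field $V$. Curvature sign convention: $R_{ij}$ is the Ricci tensor and $R=g^{ij}R_{ij}$ the scalar curvature, with the overall sign opposite to the most common modern one, so that the standard round sphere with its positive definite metric has negative definite Ricci tensor and negative scalar curvature. That is, $R_{ij}=-\mathrm{Ric}_{ij}$ and $R=-\mathrm{Scal}$, where $\mathrm{Ric}$ and $\mathrm{Scal}=g^{ij}\mathrm{Ric}_{ij}$ are normalized so that the unit round sphere $S^n$ has $\mathrm{Ric}=(n-1)g$. The conformal group of $(M,g)$ is the group of diffeomorphisms $f:M\to M$ with $f^*g=q^2g$ for some positive smooth function $q$ (depending on $f$); its ordinary pointwise action on functions is $(f\cdot\phi)(x)=\phi(f^{-1}(x))$. *)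

(* Defs.v *)
From mathcomp Require Export all_boot all_order all_algebra.
From mathcomp Require Export all_classical all_reals all_analysis.
Export Order.TTheory GRing.Theory Num.Theory.
Export numFieldNormedType.Exports.

Set Implicit Arguments.
Unset Strict Implicit.
Unset Printing Implicit Defensive.

Local Open Scope classical_set_scope.
Local Open Scope ring_scope.

Section Calculus.
Context {R : realType} {n : nat}.
Implicit Types (u : 'rV[R]_n -> R) (U : set 'rV[R]_n).

Definition partial (i : 'I_n) u : 'rV[R]_n -> R :=
  fun y => 'D_(delta_mx 0 i) u y.

Fixpoint partials (s : seq 'I_n) u : 'rV[R]_n -> R :=
  if s is i :: s' then partial i (partials s' u) else u.

(* C^oo on U (meant for open U): all iterated partial derivatives exist and are
   continuous at every point of U. *)
Definition smooth_on U u : Prop :=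
  forall (s : seq 'I_n) (y : 'rV[R]_n), U y ->
    {for y, continuous (partials s u)} /\
    forall i : 'I_n, derivable (partials s u) y (delta_mx 0 i).

End Calculus.

(* [cmap] and [cinv] are total functions, but only their values on [cdom] and
   on [cmap @` cdom] respectively are meaningful. *)
Record chart (R : realType) (n : nat) (M : topologicalType) := Chart {
  cdom : set M ;
  cmap :> M -> 'rV[R]_n ;
  cinv : 'rV[R]_n -> M ;
  cdom_open : open cdom ;
  cimg_open : open (cmap @` cdom) ;
  cmapK : forall x, cdom x -> cinv (cmap x) = x ;
  cmap_continuous : forall x, cdom x -> {for x, continuous cmap} ;
  cinv_continuous : forall y, (cmap @` cdom) y -> {for y, continuous cinv}
}.

Section LocalExpression.
Context {R : realType} {n : nat} {M : topologicalType}.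
Implicit Types (c d : chart R n M) (f : M -> M).

Definition local_dom c d f : set 'rV[R]_n := c @` (cdom c `&` f @^-1` cdom d).

Definition local_coord c d f (k : 'I_n) : 'rV[R]_n -> R :=
  fun y => d (f (cinv c y)) 0 k.

End LocalExpression.

(* [chart_at] is an arbitrary choice of a chart around each point; geometric
   quantities at [x] are computed in the coordinates [chart_at x]. *)
Record smoothManifold (R : realType) (n : nat) := SmoothManifold {
  carrier :> topologicalType ;
  manifold_hausdorff : hausdorff_space carrier ;
  manifold_second_countable : @second_countable carrier ;
  atlas : set (chart R n carrier) ;
  chart_at : carrier -> chart R n carrier ;
  chart_at_atlas : forall x, atlas (chart_at x) ;
  chart_at_dom : forall x, cdom (chart_at x) x ;
  atlas_compat : forall c d, atlas c -> atlas d ->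
    forall k, smooth_on (local_dom c d id) (local_coord c d id k)
}.

Arguments atlas {R n} M _ : rename.

Section Manifold.
Context {R : realType} {n : nat}.
Implicit Type M : smoothManifold R n.

Definition smooth_fun M (phi : M -> R) : Prop :=
  forall c, atlas M c -> smooth_on (c @` cdom c) (phi \o cinv c).

Definition smooth_map M (f : M -> M) : Prop :=
  continuous f /\
  forall c d, atlas M c -> atlas M d ->
    forall k, smooth_on (local_dom c d f) (local_coord c d f k).

Record diffeo M := Diffeo {
  dfun :> M -> M ;
  dinv : M -> M ;
  dfunK : cancel dfun dinv ;
  dinvK : cancel dinv dfun ;
  dfun_smooth : smooth_map dfun ;
  dinv_smooth : smooth_map dinv
}.

(* A covariant 2-tensor field is the family [h] of its component matrices, one
   for each chart of the atlas, as functions of the coordinates.  This is the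
   component matrix of the pullback of [h] along [f], in the chart [c] at [x],
   where [d] is a chart around [f x]. *)
Definition pullback M (h : chart R n M -> 'rV[R]_n -> 'M[R]_n) (f : M -> M)
    (c d : chart R n M) (x : M) : 'M[R]_n :=
  \matrix_(i, j) \sum_k \sum_l
    partial i (local_coord c d f k) (c x) *
    partial j (local_coord c d f l) (c x) * h d (d (f x)) k l.

(* Nondegenerate of arbitrary signature.  [metric_tensor] is the transformation
   law under changes of coordinates. *)
Record metric M := Metric {
  comp :> chart R n M -> 'rV[R]_n -> 'M[R]_n ;
  metric_smooth : forall c, atlas M c ->
    forall i j, smooth_on (c @` cdom c) (fun y => comp c y i j) ;
  metric_sym : forall c x, atlas M c -> cdom c x ->
    (comp c (c x))^T = comp c (c x) ;
  metric_nondeg : forall c x, atlas M c -> cdom c x ->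
    comp c (c x) \in unitmx ;
  metric_tensor : forall c d x, atlas M c -> atlas M d ->
    cdom c x -> cdom d x -> comp c (c x) = pullback comp id c d x
}.

Definition conformally_related M (g1 g2 : metric M) (p : M -> R) : Prop :=
  forall c x, atlas M c -> cdom c x ->
    g1 c (c x) = p x ^+ 2 *: g2 c (c x).

Definition conformal_group M (g : metric M) : set (diffeo M) :=
  [set f | exists q : M -> R,
    [/\ smooth_fun q, forall x, 0 < q x &
        forall c d x, atlas M c -> atlas M d -> cdom c x -> cdom d (f x) ->
          pullback g f c d x = q x ^+ 2 *: g c (c x)]].

End Manifold.

Section TensorCalculus.
Context {R : realType} {n : nat}.
(* [g y i j] is the component g_ij at the point of coordinates [y]. *)
Variable g : 'rV[R]_n -> 'M[R]_n.
Implicit Types (i j k l : 'I_n) (y : 'rV[R]_n) (u : 'rV[R]_n -> R).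

Definition ginv i j y : R := invmx (g y) i j.

(* Gamma^k_ij *)
Definition christoffel k i j y : R :=
  2^-1 * \sum_l ginv k l y *
    (partial i (fun z => g z j l) y + partial j (fun z => g z i l) y
     - partial l (fun z => g z i j) y).

(* T_i w_j *)
Definition nabla_covector (w : 'I_n -> 'rV[R]_n -> R) i j y : R :=
  partial i (w j) y - \sum_k christoffel k i j y * w k y.

(* T_i V^j *)
Definition nabla_vector (V : 'I_n -> 'rV[R]_n -> R) i j y : R :=
  partial i (V j) y + \sum_k christoffel j i k y * V k y.

Definition laplace u y : R :=
  \sum_i \sum_j ginv i j y * nabla_covector (fun k => partial k u) i j y.

Definition divergence (V : 'I_n -> 'rV[R]_n -> R) y : R :=
  \sum_j nabla_vector V j j y.

(* R_ij, with the sign for which the round spheres have negative definite Ricci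
   tensor: the parenthesis is the Ricci tensor of the opposite convention. *)
Definition ricci i j y : R :=
  - (\sum_k (partial k (christoffel k i j) y - partial j (christoffel k i k) y)
     + \sum_k \sum_l (christoffel k k l y * christoffel l i j y
                      - christoffel k j l y * christoffel l i k y)).

(* R^ij *)
Definition ricci_up i j y : R :=
  \sum_k \sum_l ginv i k y * ginv j l y * ricci k l y.

Definition scalar_curv y : R := \sum_i \sum_j ginv i j y * ricci i j y.

Definition ricci_sq y : R := \sum_i \sum_j ricci_up i j y * ricci i j y.

Definition Qop u y : R :=
  let N : R := n%:R in
  laplace (laplace u) y
  + divergence (fun j z => \sum_i
      (- (4 / (N - 2)) * ricci_up i j z
       + (N ^+ 2 - 4 * N + 8) / (2 * (N - 1) * (N - 2))
         * (ginv i j z * scalar_curv z)) * partial i u z) y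
  + ((N - 4) / (4 * (N - 1)) * laplace scalar_curv y
     - (N - 4) / (N - 2) ^+ 2 * ricci_sq y
     + (N - 4) * (N ^+ 3 - 4 * N ^+ 2 + 16 * N - 16)
       / (16 * (N - 1) ^+ 2 * (N - 2) ^+ 2) * scalar_curv y ^+ 2) * u y.

Definition Qop4 u y : R :=
  laplace (laplace u) y
  - 2 * divergence (fun j z => \sum_i
      (ricci_up i j z - 3^-1 * (ginv i j z * scalar_curv z)) * partial i u z) y.

End TensorCalculus.

Section Operators.
Context {R : realType} {n : nat} {M : smoothManifold R n}.
Implicit Types (g : metric M) (phi : M -> R).

(* The operator on functions on [M] given in local coordinates by [Q]. *)
Definition operator_on_M
    (Q : ('rV[R]_n -> 'M[R]_n) -> ('rV[R]_n -> R) -> 'rV[R]_n -> R) g phi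
    : M -> R :=
  fun x => let c := chart_at x in Q (g c) (phi \o cinv c) (c x).

Definition paneitz g phi : M -> R := operator_on_M Qop g phi.

Definition paneitz4 g phi : M -> R := operator_on_M Qop4 g phi.

Definition ker_paneitz g : set (M -> R) :=
  [set phi | smooth_fun phi /\ forall x, paneitz g phi x = 0].

Definition act (f : diffeo M) phi : M -> R := fun x => phi (dinv f x).

End Operators.

(* Main.v *)
(* Smooth functions on an open set of R^n form a commutative ring with commuting
   derivations, and all the tensor calculus is done in such a ring.  With the
   Schouten tensor P and its trace J (with the usual signs) and
   a = (n - 4) / 2, one has
     Q f = L L f + 4 (<P, Hess f> + <dJ, df>) - (n - 2) (J L f + <dJ, df>)
           + a (- L J - 2 <P, P> + (a + 2) J^2) f,
   which contains no divergence thanks to the contracted Bianchi identity.  Every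
   ingredient is determined by the pairing <df, dh>: the Hessian by
     2 Hess f (dh, du) = <dh, d<df, du>> + <du, d<df, dh>> - <df, d<dh, du>>,
   L as its trace, and Ric by the polarised Bochner formula.  A ring morphism that
   scales the pairing by e^(2 w) therefore transforms Hess, L, Ric, P and J in an
   explicit way, and the transformation law of Q is a polynomial identity.  With
   the identity as morphism this is the conformal covariance; with the composition
   by a conformal diffeomorphism it is the invariance of the kernel. *)
From HB Require Import structures.
Require Import Defs.
From mathcomp Require Import ring lra.

Set Implicit Arguments.
Unset Strict Implicit.
Unset Printing Implicit Defensive.

Local Open Scope classical_set_scope.
Local Open Scope ring_scope.

(** * Calculus of smooth functions *)

(** The ring of smooth functions may have zero divisors, so nothing is divided by a function: a
    metric carries its inverse, e^(-2 w) and e^(2 w) are two elements with product 1, and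
    exponentials are known only through their differential equations. Tensor identities can be
    tested on functions because the coordinate functions belong to the ring and their differentials
    form a basis. The constants come from w = ln p. With a = (n - 4) / 2 the ring identity reads
    e^(a w) Q(g_1) f = e^(-4 w) Q(g_2) (e^(a w) f), and (n + 4) / 2 = a + 4. The identity is proved
    for a map between two coordinate domains, each with its own metric. One statement thus serves
    two metrics in the chart of one point as well as one metric in the charts of x and f(x), and
    changes of charts are absorbed into it. The analytic price is the chain rule and the symmetry of
    second derivatives, both derived from the existence and continuity of iterated partial
    derivatives. *)

Section Partial.
Context {R : realType} {n : nat}.
Implicit Types (u v : 'rV[R]_n -> R) (U : set 'rV[R]_n) (i j : 'I_n).
Local Notation e_ i := (delta_mx 0 i : 'rV[R]_n).

Lemma is_derive_line u (z v : 'rV[R]_n) (t : R) : derivable u (t *: v + z) v ->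
  is_derive t 1 (fun s : R => u (s *: v + z)) ('D_v u (t *: v + z)).
Proof.
have e : (fun h : R => h^-1 *: ((fun s : R => u (s *: v + z)) (h *: 1 + t)
      - u (t *: v + z))) =
    (fun h : R => h^-1 *: (u (h *: v + (t *: v + z)) - u (t *: v + z))).
  by apply/funext => h; rewrite addrA -scalerDl [_ *: 1]mulr1.
by move=> du; apply: DeriveDef; rewrite /derivable /derive /= e.
Qed.

Lemma norm_delta i : `|e_ i| <= 1.
Proof.
rewrite /Num.Def.normr/= mx_normrE; apply: bigmax_le => // -[a b] _ /=.
by rewrite !mxE; case: (_ && _); rewrite ?normr1 ?normr0.
Qed.

Lemma derive_line u (y v : 'rV[R]_n) :
  'D_v u y = 'D_1 (fun h : R => u (h *: v + y)) 0.
Proof.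
rewrite /derive; set p := (X in lim (X @ _)); set q := (X in _ = lim (X @ _)).
suff -> : p = q by [].
by apply/funext => h; rewrite /p /q/= addr0 scale0r add0r [_%:A]mulr1.
Qed.

Lemma is_derive_comp1 u (f : R -> R) (a : R) (y v : 'rV[R]_n) :
  is_derive (u y) 1 f a -> derivable u y v ->
  is_derive y v (f \o u) (a * 'D_v u y).
Proof.
move=> df du; pose g (h : R) := u (h *: v + y).
have dg : is_derive (0 : R) 1 g ('D_v u y).
  by have := @is_derive_line u y v 0; rewrite scale0r add0r; apply.
have df' : is_derive (g 0) 1 f a by rewrite /g scale0r add0r.
have dfg := @is_derive1_comp _ _ _ _ _ _ df' dg.
apply: DeriveDef; first by apply/derivable1P; exact: ex_derive.
by rewrite derive_line; exact: derive_val.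
Qed.

(** The mean value theorem along a coordinate line. As [t] may have either sign, the intermediate
    point is located only by its absolute value, which is all that the sup norm estimates use. *)
Lemma line_mvt u (z : 'rV[R]_n) i (t : R) :
  (forall s : R, `|s| <= `|t| -> derivable u (s *: e_ i + z) (e_ i)) ->
  exists2 s, `|s| <= `|t| & u (t *: e_ i + z) - u z = t * partial i u (s *: e_ i
    + z).
Proof.
move=> du.
pose f (s : R) := u (s *: e_ i + z).
have df (s : R) : `|s| <= `|t| -> is_derive s 1 f (partial i u (s *: e_ i + z)).
  by move=> /du /is_derive_line.
have fc (a b : R) : (forall s, s \in `[a, b] -> `|s| <= `|t|) -> {within `[a, b],
  continuous f}.
  move=> ab; apply: derivable_within_continuous => s /ab /df ds.
  exact: ex_derive.
have [t0|t0] := leP 0 t.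
  have ab (s : R) : s \in `[0, t] -> `|s| <= `|t|.
    by rewrite in_itv/= => /andP[s0 st]; rewrite !ger0_norm.
  have [] := @MVT_segment R f (fun s => partial i u (s *: e_ i + z)) 0 t t0.
  - by move=> s; rewrite in_itv/= => /andP[s0 st]; apply/df/ab;
    rewrite in_itv/= !ltW.
  - exact: fc.
  move=> s /ab st E; exists s => //.
  by rewrite -{2}(add0r z) -(scale0r (e_ i)) E subr0 mulrC.
have ab (s : R) : s \in `[t, 0] -> `|s| <= `|t|.
  by rewrite in_itv/= => /andP[s0 st]; rewrite !ler0_norm ?lerN2// ltW.
have [] := @MVT_segment R f (fun s => partial i u (s *: e_ i + z)) t 0 (ltW t0).
- by move=> s; rewrite in_itv/= => /andP[s0 st]; apply/df/ab; rewrite in_itv/= !ltW.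
- exact: fc.
move=> s /ab st E; exists s => //.
rewrite -{2}(add0r z) -(scale0r (e_ i)) -[LHS]opprB E; ring.
Qed.

Lemma row_norm_le (v : 'rV[R]_n) (c : R) :
  0 <= c -> (forall j, `|v 0 j| <= c) -> `|v| <= c.
Proof.
move=> c0 vc; rewrite /Num.Def.normr/= mx_normrE;
  apply: bigmax_le => // -[a b] _ /=.
by rewrite (ord1 a).
Qed.

Lemma coord_norm_le (v : 'rV[R]_n) j : `|v 0 j| <= `|v|.
Proof.
by rewrite [leRHS]/Num.Def.normr/= mx_normrE; exact: (le_bigmax _ _ (0, j)).
Qed.

Let dlin u y (h : 'rV[R]_n) : R := \sum_i h 0 i * partial i u y.

Let dlin_linear u y : linear (dlin u y).
Proof.
move=> a h k; rewrite /dlin scaler_sumr -big_split; apply: eq_bigr => i _.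
by rewrite !mxE mulrDl -mulrA.
Qed.

Let dlin_continuous u y : continuous (dlin u y).
Proof.
apply: continuous_big => [|i _ h]; first exact: add_continuous.
apply: (@continuousM _ _ (fun x : 'rV[R]_n => x 0 i) (cst (partial i u y)));
  [exact: coord_continuous|exact: cst_continuous].
Qed.

Let partial_step (h : 'rV[R]_n) (k : nat) : 'rV[R]_n := \row_j (if (j < k)%N then
  h 0 j else 0).

(** Go from [y] to [h + y] one coordinate at a time: [partial_step h k] keeps the first [k]
    coordinates of [h]. By the mean value theorem each step is h_i times a partial derivative at a
    nearby point, and continuity replaces that point by [y]. *)
Lemma expansion u y (e : R) : 0 < e ->
  (\forall z \near y, forall i, derivable u z 'e_i) ->
  (forall i, {for y, continuous (partial i u)}) ->
  \forall h \near 0, `|u (h + y) - (u y + dlin u y h)| <= e * `|h|.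
Proof.
(* Each of the n steps costs an error of at most e' |h|; [n.+1] keeps the divisor nonzero when n =
   0. *)
move=> e0 du cu; pose e' := e / n.+1%:R; have e'0 : 0 < e' by rewrite divr_gt0.
have near_i i : \forall z \near y, derivable u z 'e_i /\
    `|partial i u y - partial i u z| <= e'.
  apply: filterI; first by apply: filterS du => z.
  by have /cvgrPdist_le/(_ _ e'0) := cu i.
have [d /= d0 dP] : nbhs_ball y (fun z => forall i, derivable u z 'e_i /\
    `|partial i u y - partial i u z| <= e').
  by apply/nbhs_ballP; exact: (filter_forall _ near_i).
near=> h.
have hd : `|h| < d by near: h; exact: (@nbhs0_lt R 'rV[R]_n d d0).
have step (i : 'I_n) : `|u (partial_step h i.+1 + y) - u (partial_step h i + y) -
  h 0 i * partial i u y|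
    <= `|h| * e'.
  have partial_stepS : partial_step h i.+1 = h 0 i *: 'e_i + partial_step h i.
    apply/rowP => j; rewrite !mxE eqxx/= ltnS leq_eqVlt -val_eqE/=.
    by case: ltngtP => [| |/val_inj ->]; rewrite ?mulr0 ?add0r ?mulr1 ?addr0.
  (* In the sup norm the intermediate points are no farther from [y] than [h + y] is, so they stay
     in the ball. *)
  have inb s : `|s| <= `|h 0 i| -> ball y d (s *: 'e_i + (partial_step h i + y)).
    move=> sh; rewrite -ball_normE/= addrA [_ + y]addrC opprD addrA subrr add0r.
    rewrite normrN.
    apply: le_lt_trans hd; apply: row_norm_le => // j; rewrite !mxE eqxx/=.
    case: (eqVneq j i) => [->|ji]; rewrite ?ltnn ?mulr1 ?mulr0 ?addr0 ?add0r.
      exact: le_trans sh (coord_norm_le _ _).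
    by case: ifP; rewrite ?coord_norm_le ?normr0.
  rewrite partial_stepS -[_ + partial_step h i + y]addrA.
  have [s sh|s sh ->] := @line_mvt u (partial_step h i + y) i (h 0 i).
    by have [] := dP _ (inb _ sh) i.
  rewrite -mulrBr normrM ler_pM ?coord_norm_le// distrC.
  by have [] := dP _ (inb _ sh) i.
have -> : u (h + y) - (u y + dlin u y h) =
    \sum_(i < n) (u (partial_step h i.+1 + y) - u (partial_step h i + y) - h 0 i
      * partial i u y).
  rewrite sumrB -(big_mkord xpredT (fun k => u (partial_step h k.+1 + y) - u
    (partial_step h k + y))).
  rewrite (telescope_sumr (fun k => u (partial_step h k + y)))// opprD addrA;
    congr (u (_ + _) - u _ - _).
    by apply/rowP => j; rewrite mxE ltn_ord.
  by rewrite (_ : partial_step h 0 = 0) ?add0r//; apply/rowP => j; rewrite !mxE.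
apply: le_trans (ler_norm_sum _ _ _) _.
apply: le_trans (ler_sum _ (fun i _ => step i)) _.
rewrite sumr_const card_ord -mulr_natr -mulrA mulrC ler_wpM2r//.
by rewrite /e' -mulrA ler_piMr ?(ltW e0)// mulrC ler_pdivrMr// mul1r ler_nat.
Unshelve. all: by end_near. Qed.

Lemma C1_differentiable u y :
  (\forall z \near y, forall i, derivable u z 'e_i) ->
  (forall i, {for y, continuous (partial i u)}) ->
  differentiable u y.
Proof.
move=> du cu.
pose L := GRing.isLinear.Build R 'rV[R]_n R _ _ (@dlin_linear u y).
pose df : {linear 'rV[R]_n -> R} := HB.pack (dlin u y) L.
have dfo : u \o shift y = cst (u y) + df +o_ 0 id.
  by apply/eqaddoP => _/posnumP[e]; apply: expansion.
apply/diff_locallyP; rewrite (diff_unique _ dfo); last exact: dlin_continuous.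
by split => //; exact: dlin_continuous.
Qed.

Lemma diff_partial u y (v : 'rV[R]_n) : differentiable u y ->
  'd u y v = \sum_k v 0 k * partial k u y.
Proof.
move=> du; rewrite {1}(row_sum_delta v) linear_sum; apply: eq_bigr => k _.
by rewrite linearZ /partial deriveE.
Qed.

(** Restricting [F] to the line through [y] in direction i reduces the chain rule to a curve, so [F]
    only has to be derivable in that one direction; [u] has to be totally differentiable. *)
Lemma partial_comp u (F : 'rV[R]_n -> 'rV[R]_n) y i :
  (forall k, derivable (fun z => F z 0 k) y 'e_i) ->
  differentiable u (F y) ->
  derivable (u \o F) y 'e_i /\
  partial i (u \o F) y =
    \sum_k partial i (fun z => F z 0 k) y * partial k u (F y).
Proof.
move=> dF du; pose G (h : R) := F (h *: 'e_i + y).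
have dFv : derivable F y 'e_i by apply/derivable_mxP => a b; rewrite (ord1 a).
have G0 : G 0 = F y by rewrite /G scale0r add0r.
have dG1 : derivable G 0 1 by move/derivable1P : dFv.
have dG : differentiable G 0 by apply/derivable1_diffP.
have duG : differentiable (u \o G) 0 by apply: differentiable_comp; rewrite ?G0.
have d1 : derivable (u \o F) y 'e_i.
  by apply/derivable1P/derivable1_diffP.
split => //.
rewrite /partial derive_line (deriveE _ duG) [X in 'd X _ _]/(u \o G)
  diff_comp//; last by rewrite G0.
rewrite /= G0 diff_partial//; apply: eq_bigr => k _; congr (_ * _).
rewrite -deriveE// derive_mx// mxE.
by rewrite [RHS]derive_line.
Qed.

End Partial.

(** * Closure properties of smooth functions and symmetry of second derivatives *)

Section Smooth.
Context {R : realType} {n : nat}.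
Implicit Types (u v : 'rV[R]_n -> R) (U : set 'rV[R]_n) (i j : 'I_n).

Lemma partial_near u v y i : (\near y, u y = v y) -> partial i u y = partial i v y.
Proof. exact: near_eq_derive. Qed.

Lemma open_near U y (P : 'rV[R]_n -> Prop) :
  open U -> U y -> (forall z, U z -> P z) -> \forall z \near y, P z.
Proof. by move=> oU Uy UP; apply: filterS UP _; exact: open_nbhs_nbhs. Qed.

Lemma partials_eq U u v s : open U -> (forall y, U y -> u y = v y) ->
  forall y, U y -> partials s u y = partials s v y.
Proof.
move=> oU uv; elim: s => [|i s IH]//= y Uy.
by apply: partial_near; exact: open_near IH.
Qed.

Lemma continuous_near u v (y : 'rV[R]_n) :
  (\near y, u y = v y) -> {for y, continuous u} -> {for y, continuous v}.
Proof.
move=> uv cu; rewrite /prop_for /continuous_at -(nbhs_singleton uv).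
exact: cvg_trans (near_eq_cvg uv) cu.
Qed.

Lemma eq_smooth_on U u v : open U -> (forall y, U y -> u y = v y) ->
  smooth_on U u -> smooth_on U v.
Proof.
move=> oU uv su s y Uy; have [c d] := su s y Uy.
have e : \near y, partials s u y = partials s v y.
  by apply: open_near (partials_eq _ oU uv).
split; first exact: continuous_near e c.
by move=> i; apply: near_eq_derivable (d i).
Qed.

Lemma smooth_onS U V u : V `<=` U -> smooth_on U u -> smooth_on V u.
Proof. by move=> VU su s y /VU; exact: su. Qed.

Lemma smooth_on_local U u :
  (forall y, U y -> exists V, [/\ open V, V y & smooth_on V u]) -> smooth_on U u.
Proof. by move=> UV s y /UV[V [_ Vy sV]]; exact: sV. Qed.

Lemma partials_rcons s i u : partials (rcons s i) u = partials s (partial i u).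
Proof. by elim: s => //= j s ->. Qed.

Lemma smooth_on_partial U u i : smooth_on U u -> smooth_on U (partial i u).
Proof. by move=> su s y Uy; rewrite -partials_rcons; exact: su. Qed.

Lemma smooth_on_continuous U u y :
  smooth_on U u -> U y -> {for y, continuous u}.
Proof. by move=> su Uy; have [] := su [::] y Uy. Qed.

Lemma smooth_on_derivable U u y i :
  smooth_on U u -> U y -> derivable u y 'e_i.
Proof. by move=> su Uy; have [] := su [::] y Uy. Qed.

Lemma smooth_on_differentiable U u y :
  open U -> smooth_on U u -> U y -> differentiable u y.
Proof.
move=> oU su Uy; apply: C1_differentiable.
  by apply: open_near Uy _ => // z Uz i; exact: smooth_on_derivable su Uz.
by move=> i; apply: smooth_on_continuous Uy; exact: smooth_on_partial.
Qed.

(** Differentiability of finite order, with the first derivative taken innermost. This gives an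
    induction on the order: a closure property at order k + 1 follows from order k applied to an
    expression for the first derivatives. *)
Fixpoint Ck k U u : Prop :=
  (forall y, U y -> {for y, continuous u} /\ forall i, derivable u y 'e_i) /\
  if k is k'.+1 then forall i, Ck k' U (partial i u) else True.

Lemma smooth_on_Ck U u : smooth_on U u <-> forall k, Ck k U u.
Proof.
split=> [su k|ck s].
  elim: k u su => [|k IH] u su; split=> //.
  - by move=> y Uy; exact: su [::] y Uy.
  - by move=> y Uy; exact: su [::] y Uy.
  - by move=> i; apply: IH; exact: smooth_on_partial.
elim/last_ind: s u ck => [|s i IH] u ck y Uy.
  by have [c _] := ck 0%N; exact: c.
rewrite partials_rcons; apply: IH => // k.
by have [_] := ck k.+1; exact.
Qed.

Lemma Ck0 k U u : Ck k U u -> Ck 0 U u.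
Proof. by case: k => [|k] []. Qed.

Lemma CkS k U u : Ck k.+1 U u -> Ck k U u.
Proof.
elim: k u => [|k IH] u; first by move=> /Ck0.
by case=> c0 cS; split => // i; exact: IH.
Qed.

Lemma eq_Ck k U u v : open U -> (forall y, U y -> u y = v y) -> Ck k U u -> Ck k
  U v.
Proof.
move=> oU; elim: k u v => [|k IH] u v uv [c0 cS]; split; [ | by [] | | ].
- move=> y Uy; have [c d] := c0 y Uy.
  have e : \near y, u y = v y by apply: open_near uv.
  by split=> [|i]; [exact: continuous_near e c|exact: near_eq_derivable (d i)].
- move=> y Uy; have [c d] := c0 y Uy.
  have e : \near y, u y = v y by apply: open_near uv.
  by split=> [|i]; [exact: continuous_near e c|exact: near_eq_derivable (d i)].
- move=> i; apply: IH (cS i) => y Uy; apply: partial_near.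
  exact: open_near uv.
Qed.

Lemma partialM u v y i : derivable u y 'e_i -> derivable v y 'e_i ->
  partial i (fun z => u z * v z) y = partial i u y * v y + u y * partial i v y.
Proof.
move=> du dv; transitivity ('D_('e_i) (u * v) y); first by [].
by rewrite (deriveM du dv) addrC; congr (_ + _); exact: mulrC.
Qed.

Lemma partialD u v y i : derivable u y 'e_i -> derivable v y 'e_i ->
  partial i (fun z => u z + v z) y = partial i u y + partial i v y.
Proof. by move=> du dv; have := deriveD du dv. Qed.

Lemma partial_cst c y i : partial i (fun=> c) y = 0 :> R.
Proof. exact: derive_cst. Qed.

Lemma CkSI k U u : open U -> Ck 0 U u ->
  (forall i, exists2 v, (forall y, U y -> v y = partial i u y) & Ck k U v) ->
  Ck k.+1 U u.
Proof.
by move=> oU [c0 _] cS; split=> // i; have [v vE] := cS i; exact: eq_Ck.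
Qed.

Lemma Ck_cst k U c : open U -> Ck k U (fun=> c).
Proof.
move=> oU; have c0 : Ck 0 U (fun=> c).
  by split=> // y _; split=> [|i]; [exact: cst_continuous|exact: derivable_cst].
elim: k c c0 => [//|k IH] c c0; apply: CkSI => // i; exists (fun=> 0).
  by move=> y _; rewrite partial_cst.
by apply: IH; split=> // y _; split=> [|j];
  [exact: cst_continuous|exact: derivable_cst].
Qed.

Lemma Ck_D k U u v : open U -> Ck k U u -> Ck k U v -> Ck k U (fun z => u z + v z).
Proof.
move=> oU; elim: k u v => [|k IH] u v cu cv; have [cu0 _] := Ck0 cu;
  have [cv0 _] := Ck0 cv.
  split; last by [].
  move=> y Uy; split=> [|i]; first by apply: continuousD;
    [exact: (cu0 y Uy).1|exact: (cv0 y Uy).1].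
  by apply: derivableD; [exact: (cu0 y Uy).2|exact: (cv0 y Uy).2].
apply: (CkSI oU); first by apply: Ck0 (IH _ _ (CkS cu) (CkS cv)).
move=> i; exists (fun z => partial i u z + partial i v z).
  by move=> y Uy; rewrite partialD; [|exact: (cu0 y Uy).2|exact: (cv0 y Uy).2].
by apply: IH; [exact: cu.2|exact: cv.2].
Qed.

Lemma Ck_M k U u v : open U -> Ck k U u -> Ck k U v -> Ck k U (fun z => u z * v z).
Proof.
move=> oU; elim: k u v => [|k IH] u v cu cv; have [cu0 _] := Ck0 cu;
  have [cv0 _] := Ck0 cv.
  split; last by [].
  move=> y Uy; split=> [|i]; first by apply: continuousM;
    [exact: (cu0 y Uy).1|exact: (cv0 y Uy).1].
  by apply: derivableM; [exact: (cu0 y Uy).2|exact: (cv0 y Uy).2].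
apply: (CkSI oU); first by apply: Ck0 (IH _ _ (CkS cu) (CkS cv)).
move=> i; exists (fun z => partial i u z * v z + u z * partial i v z).
  by move=> y Uy; rewrite partialM; [|exact: (cu0 y Uy).2|exact: (cv0 y Uy).2].
by apply: Ck_D => //; apply: IH; rewrite ?CkS//;
  [exact: cu.2|exact: CkS|exact: CkS|exact: cv.2].
Qed.

(* Covers exp, ln and the inverse: their derivatives are smooth expressions in
   the function itself and its argument. *)
Lemma Ck_comp1 k U u (f f' : R -> R) : open U ->
  (forall y, U y -> is_derive (u y) 1 f (f' (u y))) ->
  (forall k, Ck k U u -> Ck k U (f \o u) -> Ck k U (f' \o u)) ->
  Ck k U u -> Ck k U (f \o u).
Proof.
move=> oU df cf'; elim: k => [|k IH] cu; have [cu0 _] := Ck0 cu.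
  split; last by [].
  move=> y Uy; split=> [|i].
    apply: continuous_comp; first exact: (cu0 y Uy).1.
    have := df y Uy => dfy.
    by apply/differentiable_continuous/derivable1_diffP; exact: ex_derive.
  by have dfu := is_derive_comp1 (df y Uy) ((cu0 y Uy).2 i); exact: ex_derive.
apply: (CkSI oU); first by apply: Ck0 (IH (CkS cu)).
move=> i; exists (fun z => f' (u z) * partial i u z).
  move=> y Uy; have dfu := is_derive_comp1 (df y Uy) ((cu0 y Uy).2 i).
  by rewrite /partial derive_val.
apply: Ck_M => //; last exact: cu.2.
by apply: cf'; [exact: CkS|apply: IH; exact: CkS].
Qed.

Lemma smooth_cst U c : open U -> smooth_on U (fun=> c).
Proof. by move=> oU; apply/smooth_on_Ck => k; exact: Ck_cst. Qed.

Lemma smoothD U u v : open U -> smooth_on U u -> smooth_on U v ->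
  smooth_on U (fun z => u z + v z).
Proof.
by move=> oU /smooth_on_Ck cu /smooth_on_Ck cv; apply/smooth_on_Ck => k;
  exact: Ck_D.
Qed.

Lemma smoothM U u v : open U -> smooth_on U u -> smooth_on U v ->
  smooth_on U (fun z => u z * v z).
Proof.
by move=> oU /smooth_on_Ck cu /smooth_on_Ck cv; apply/smooth_on_Ck => k;
  exact: Ck_M.
Qed.

Lemma smoothN U u : open U -> smooth_on U u -> smooth_on U (fun z => - u z).
Proof.
move=> oU su; have e y : U y -> -1 * u y = - u y by rewrite mulN1r.
apply: (eq_smooth_on oU e).
by apply: (smoothM oU _ su); exact: smooth_cst.
Qed.

Lemma smoothV U u : open U -> (forall y, U y -> u y != 0) -> smooth_on U u ->
  smooth_on U (fun z => (u z)^-1).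
Proof.
move=> oU u0 /smooth_on_Ck cu; apply/smooth_on_Ck => k.
apply: (@Ck_comp1 k U u (fun x => x^-1) (fun x => - (x^-1 * x^-1))) => //.
  move=> y Uy; have := u0 y Uy; move: (u y) => a a0.
  have d := @derivable_id R R a 1.
  apply: DeriveDef; first exact: derivableV.
  by rewrite (deriveV a0 d) derive_id /GRing.scale/= mulr1 expr2 invfM.
move=> m cm cf.
have e y : U y -> -1 * ((u y)^-1 * (u y)^-1) = - ((u y)^-1 * (u y)^-1).
  by rewrite mulN1r.
by apply: (eq_Ck oU e); apply: Ck_M => //; [exact: Ck_cst|apply: Ck_M].
Qed.

Lemma smooth_expR U u : open U -> smooth_on U u -> smooth_on U (fun z => expR (u
  z)).
Proof.
move=> oU /smooth_on_Ck cu; apply/smooth_on_Ck => k.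
by apply: (@Ck_comp1 k U u (@expR R) (@expR R)).
Qed.

Lemma smooth_ln U u : open U -> (forall y, U y -> 0 < u y) -> smooth_on U u ->
  smooth_on U (fun z => ln (u z)).
Proof.
move=> oU u0 su; have /smooth_on_Ck cu := su.
have /smooth_on_Ck cV : smooth_on U (fun z => (u z)^-1).
  by apply: smoothV => // y /u0 /lt0r_neq0.
apply/smooth_on_Ck => k.
apply: (@Ck_comp1 k U u (@ln R) (fun x => x^-1)) => // y /u0.
exact: is_derive1_ln.
Qed.

Lemma partial_coord i j (y : 'rV[R]_n) :
  partial i (fun z => z 0 j) y = (i == j)%:R.
Proof.
have d : derivable (fun z : 'rV[R]_n => z) y 'e_i by exact: derivable_id.
have := derive_mx d; rewrite derive_id => /matrixP/(_ 0 j).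
by rewrite [LHS]mxE [RHS]mxE eqxx/= eq_sym => ->.
Qed.

Lemma smooth_coord U j : open U -> smooth_on U (fun z => z 0 j).
Proof.
move=> oU; have c0 : Ck 0 U (fun z : 'rV[R]_n => z 0 j).
  split=> // y Uy; split=> [|i]; first exact: coord_continuous.
  exact/diff_derivable/differentiable_coord.
apply/smooth_on_Ck; case=> [//|k]; apply: CkSI => // i.
exists (fun=> (i == j)%:R); last exact: Ck_cst.
by move=> y _; rewrite partial_coord.
Qed.

Lemma continuous_rowP (F : 'rV[R]_n -> 'rV[R]_n) (y : 'rV[R]_n) :
  (forall l, {for y, continuous (fun z => F z 0 l)}) -> {for y, continuous F}.
Proof.
move=> cF; rewrite /prop_for /continuous_at;
  apply/(@cvgrPdist_le _ _ _ _ (nbhs_filter y)) => e e0.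
have near_l l : \forall z \near y, `|F y 0 l - F z 0 l| <= e.
  by have /cvgrPdist_le/(_ _ e0) := cF l.
have : \forall z \near y, forall l, `|F y 0 l - F z 0 l| <= e.
  exact: (@filter_forall _ _ _ _ (nbhs_filter y) near_l).
apply: filterS => z Fz.
by apply: row_norm_le => [|l]; [exact: ltW|rewrite !mxE].
Qed.

Lemma Ck_sum (I : Type) (r : seq I) (F : I -> 'rV[R]_n -> R) k U : open U ->
  (forall x, Ck k U (F x)) -> Ck k U (fun z => \sum_(x <- r) F x z).
Proof.
move=> oU sF; elim: r => [|a r IH].
  have e y : U y -> 0 = \sum_(x <- [::]) F x y by rewrite big_nil.
  by apply: (eq_Ck oU e); exact: Ck_cst.
have e y : U y -> F a y + \sum_(x <- r) F x y = \sum_(x <- a :: r) F x y.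
  by rewrite big_cons.
by apply: (eq_Ck oU e); exact: Ck_D.
Qed.

(** Induction on the order for all smooth [u] at once: the chain rule writes a derivative of u o F
    as a sum of products of a smooth derivative of [F] with (d_l u) o F, and d_l u is again
    smooth. *)
Lemma Ck_comp k U V u (F : 'rV[R]_n -> 'rV[R]_n) : open U -> open V ->
  (forall y, V y -> U (F y)) -> (forall l, smooth_on V (fun z => F z 0 l)) ->
  smooth_on U u -> Ck k V (u \o F).
Proof.
move=> oU oV VU sF; elim: k u => [|k IH] u su.
  split=> // y Vy.
  have du : differentiable u (F y) by apply: smooth_on_differentiable su (VU _ Vy).
  split=> [|i]; last first.
    have [] := @partial_comp _ _ u F y i _ du => // l.
    exact: smooth_on_derivable (sF l) Vy.
  apply: continuous_comp; last exact: differentiable_continuous.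
  by apply: continuous_rowP => l; exact: smooth_on_continuous (sF l) Vy.
apply: CkSI => //.
  exact: Ck0 (IH _ su).
move=> i; exists (fun z => \sum_l partial i (fun z => F z 0 l) z * partial l u (F
  z)).
  move=> y Vy; have du : differentiable u (F y).
    by apply: smooth_on_differentiable su (VU _ Vy).
  have [|_ ->//] := @partial_comp _ _ u F y i _ du.
  by move=> l; exact: smooth_on_derivable (sF l) Vy.
apply: Ck_sum => // l; apply: Ck_M => //.
  by move: k {IH}; apply/smooth_on_Ck; exact: smooth_on_partial.
by apply: IH; exact: smooth_on_partial.
Qed.

Lemma smooth_comp U V u (F : 'rV[R]_n -> 'rV[R]_n) : open U -> open V ->
  (forall y, V y -> U (F y)) -> (forall l, smooth_on V (fun z => F z 0 l)) ->
  smooth_on U u -> smooth_on V (u \o F).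
Proof. by move=> oU oV VU sF su; apply/smooth_on_Ck => k; exact: Ck_comp su. Qed.

(** Two mean value theorems: one in direction i for the increment of [u] along t e_j, then one in
    direction j for the partial derivative of [u] so obtained. *)
Lemma second_difference u (y : 'rV[R]_n) i j (t : R) : 0 < t ->
  (forall s s', `|s| <= t -> `|s'| <= t ->
    derivable u (s *: 'e_i + (s' *: 'e_j + y)) 'e_i /\
    derivable (partial i u) (s *: 'e_i + (s' *: 'e_j + y)) 'e_j) ->
  exists s s', [/\ `|s| <= t, `|s'| <= t &
    u (t *: 'e_i + (t *: 'e_j + y)) - u (t *: 'e_j + y) - (u (t *: 'e_i + y) - u y)
    = t ^+ 2 * partial j (partial i u) (s *: 'e_i + (s' *: 'e_j + y))].
Proof.
move=> t0 du; have tt : `|t| = t by rewrite gtr0_norm.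
pose v z := u (t *: 'e_j + z) - u z.
have sh (c z : 'rV[R]_n) : derivable u (c + z) 'e_i ->
    is_derive z 'e_i (fun w => u (c + w)) (partial i u (c + z)).
  have e : (fun h : R => h^-1 *: (u (c + (h *: 'e_i + z)) - u (c + z))) =
    (fun h : R => h^-1 *: (u (h *: 'e_i + (c + z)) - u (c + z))).
    by apply/funext => h; rewrite addrCA.
  by move=> d; apply: DeriveDef; rewrite /partial /derivable /derive /= e.
have dv (z : 'rV[R]_n) : derivable u (t *: 'e_j + z) 'e_i -> derivable u z 'e_i ->
    is_derive z 'e_i v (partial i u (t *: 'e_j + z) - partial i u z).
  move=> /sh d1 d2; have d3 : is_derive z 'e_i u (partial i u z) by apply:
    derivableP.
  exact: is_deriveB.
have dvs s : `|s| <= t -> is_derive (s *: 'e_i + y) 'e_i v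
    (partial i u (t *: 'e_j + (s *: 'e_i + y)) - partial i u (s *: 'e_i + y)).
  move=> st; apply: dv.
    by rewrite addrCA; apply: (du _ _ _ _).1 => //; rewrite tt.
  have := (du s 0 st); rewrite normr0 scale0r add0r => h.
  by have [] := h (ltW t0).
have [|s] := @line_mvt _ _ v y i t.
  by move=> s; rewrite tt => /dvs d; exact: ex_derive.
rewrite tt => st E.
have [|s'] := @line_mvt _ _ (partial i u) (s *: 'e_i + y) j t.
  by move=> s'; rewrite tt => st'; rewrite addrCA; exact: (du _ _ _ _).2.
rewrite tt => st' E'; exists s, s'; split; [exact: st|exact: st'|].
rewrite [s *: _ + _]addrCA expr2 -mulrA -E'.
have <- : partial i v (s *: 'e_i + y) =
    partial i u (t *: 'e_j + (s *: 'e_i + y)) - partial i u (s *: 'e_i + y).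
  by have d := dvs _ st; exact: derive_val.
by rewrite -E /v addrCA; ring.
Qed.

(** The second difference over a small square is symmetric in i and j, so the two mixed derivatives
    take a common value at points close to [y]; continuity brings both points back to [y]. *)
Lemma clairaut U u y i j : open U -> smooth_on U u -> U y ->
  partial i (partial j u) y = partial j (partial i u) y.
Proof.
move=> oU su Uy; apply/eqP; rewrite -subr_eq0 -normr_le0;
  apply/ler_addgt0Pr => e e0.
rewrite add0r.
have e2 : 0 < e / 2 by rewrite divr_gt0.
have c1 : {for y, continuous (partial i (partial j u))}.
  by apply: smooth_on_continuous Uy; do 2 apply: smooth_on_partial.
have c2 : {for y, continuous (partial j (partial i u))}.
  by apply: smooth_on_continuous Uy; do 2 apply: smooth_on_partial.
have : \forall z \near y, [/\ U z,
    `|partial i (partial j u) y - partial i (partial j u) z| <= e / 2 &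
    `|partial j (partial i u) y - partial j (partial i u) z| <= e / 2].
  have nU : \forall z \near y, U z by exact: open_nbhs_nbhs.
  have n1 := (@cvgrPdist_le _ _ _ _ (nbhs_filter y) _ _).1 c1 _ e2.
  have n2 := (@cvgrPdist_le _ _ _ _ (nbhs_filter y) _ _).1 c2 _ e2.
  apply: filterS (filterI nU (filterI n1 n2)) => z [Uz [h1 h2]].
  by split; [exact: Uz|exact: h1|exact: h2].
move=> /nbhs_ballP[d /= d0 dP].
(* A point of the square is displaced by at most t in each of two directions, and 2 t < d. *)
pose t := d / 3; have t0 : 0 < t by rewrite divr_gt0.
have inb k l (s s' : R) : `|s| <= t -> `|s'| <= t -> ball y d (s *: 'e_k + (s' *:
  'e_l + y)).
  move=> st st'; rewrite -ball_normE/= addrA [_ + y]addrC opprD addrA subrr add0r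
    normrN.
  apply: le_lt_trans (ler_normD _ _) _; rewrite !normrZ.
  apply: (@le_lt_trans _ _ (t + t)).
    apply: lerD.
      by apply: le_trans st; rewrite ler_piMr ?normr_ge0 ?norm_delta.
    by apply: le_trans st'; rewrite ler_piMr ?normr_ge0 ?norm_delta.
  by rewrite /t; lra.
have [|s [s' [st st' E]]] := @second_difference u y i j t t0.
  move=> s s' st st'; have [Uz _ _] := dP _ (inb i j _ _ st st').
  split; first exact: smooth_on_derivable su Uz.
  by apply: smooth_on_derivable Uz; exact: smooth_on_partial.
have [|r [r' [rt rt' E']]] := @second_difference u y j i t t0.
  move=> r r' rt rt'; have [Uz _ _] := dP _ (inb j i _ _ rt rt').
  split; first exact: smooth_on_derivable su Uz.
  by apply: smooth_on_derivable Uz; exact: smooth_on_partial.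
have [_ _ h1] := dP _ (inb i j _ _ st st').
have [_ h2 _] := dP _ (inb j i _ _ rt rt').
have EE : partial j (partial i u) (s *: 'e_i + (s' *: 'e_j + y)) =
          partial i (partial j u) (r *: 'e_j + (r' *: 'e_i + y)).
  have t20 : t ^+ 2 != 0 by rewrite expf_neq0// gt_eqF.
  move: E E'; rewrite [t *: 'e_j + (t *: 'e_i + y)]addrCA.
  move: (partial j _ _) (partial i _ _) => p q.
  move: (u (_ + (_ + _))) (u (_ *: 'e_j + y)) (u (_ *: 'e_i + y)) (u y).
  move=> a b c x E E'; apply: (mulfI t20); rewrite -E -E'; ring.
rewrite -EE in h2.
apply: le_trans (ler_distD (partial j (partial i u)
  (s *: 'e_i + (s' *: 'e_j + y))) _ _) _.
by rewrite [leRHS]splitr; apply: lerD; [exact: h2|rewrite distrC; exact: h1].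
Qed.

End Smooth.

(** * Metrics over a differential ring *)

Lemma mxDE (A : pzRingType) m q (B C : 'M[A]_(m, q)) i j :
  (B + C) i j = B i j + C i j.
Proof. exact: mxE. Qed.

Lemma mxNE (A : pzRingType) m q (B : 'M[A]_(m, q)) i j : (- B) i j = - B i j.
Proof. exact: mxE. Qed.

Lemma mxZE (A : pzRingType) m q a (B : 'M[A]_(m, q)) i j :
  (a *: B) i j = a * B i j.
Proof. exact: mxE. Qed.

Lemma mxME (A : pzRingType) m q r (B : 'M[A]_(m, q)) (C : 'M[A]_(q, r)) i j :
  (B *m C) i j = \sum_k B i k * C k j.
Proof. exact: mxE. Qed.

Lemma trmxDE (A : pzRingType) m q (B C : 'M[A]_(m, q)) : (B + C)^T = B^T + C^T.
Proof. by apply/matrixP=> i j; rewrite !mxE. Qed.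

Lemma trmxNE (A : pzRingType) m q (B : 'M[A]_(m, q)) : (- B)^T = - B^T.
Proof. by apply/matrixP=> i j; rewrite !mxE. Qed.

(** The carrier may be the zero ring, as it is for functions on an empty open set. Division is
    available only for the scalars that come through [ccst]; the coordinates [crd] provide elements
    whose differentials are the standard basis. *)
Record diffRing (R : numFieldType) (n : nat) := DiffRing {
  dsort :> comPzRingType ;
  der : 'I_n -> dsort -> dsort ;
  ccst : {rmorphism R -> dsort} ;
  crd : 'I_n -> dsort ;
  derD : forall i, {morph der i : f h / f + h} ;
  derM : forall i f h, der i (f * h) = der i f * h + f * der i h ;
  derC : forall i j f, der i (der j f) = der j (der i f) ;
  der_cst : forall i c, der i (ccst c) = 0 ;
  der_crd : forall i j, der i (crd j) = (i == j)%:R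
}.

Section DRingTheory.
Context {R : numFieldType} {n : nat} {A : diffRing R n}.
Implicit Types (f h k : A) (i j : 'I_n).

Lemma der0 i : der i (0 : A) = 0.
Proof. by apply: (addrI (der i (0 : A))); rewrite -derD !addr0. Qed.

Lemma derN i f : der i (- f) = - der i f.
Proof. by apply: (addrI (der i f)); rewrite -derD !subrr der0. Qed.

Lemma der_sum i (I : Type) (r : seq I) (P : pred I) (F : I -> A) :
  der i (\sum_(x <- r | P x) F x) = \sum_(x <- r | P x) der i (F x).
Proof. exact: (big_morph (der i) (derD i) (der0 i)). Qed.

Lemma cst_half : ccst A 2^-1 * 2 = 1.
Proof. by rewrite -(rmorph_nat (ccst A)) -rmorphM mulVf ?pnatr_eq0// rmorph1. Qed.

Lemma mul2I f h : 2 * f = 2 * h -> f = h.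
Proof. by move=> e; rewrite -[f]mul1r -[h]mul1r -cst_half -!mulrA e. Qed.

Definition grd f : 'cV[A]_n := \col_i der i f.

Lemma grdD f h : grd (f + h) = grd f + grd h.
Proof. by apply/matrixP=> i j; rewrite !mxE derD. Qed.

Lemma grdM f h : grd (f * h) = h *: grd f + f *: grd h.
Proof. by apply/matrixP=> i j; rewrite !mxE derM; ring. Qed.

Definition derm m q i (B : 'M[A]_(m, q)) : 'M[A]_(m, q) := map_mx (der i) B.

Lemma dermE m q i (B : 'M[A]_(m, q)) a b : derm i B a b = der i (B a b).
Proof. exact: mxE. Qed.

Lemma dermM m q r i (B : 'M[A]_(m, q)) (C : 'M[A]_(q, r)) :
  derm i (B *m C) = derm i B *m C + B *m derm i C.
Proof.
apply/matrixP=> a b; rewrite !mxE der_sum -big_split/=.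
by apply: eq_bigr => c _; rewrite derM !mxE.
Qed.

Lemma dermD m q i (B C : 'M[A]_(m, q)) : derm i (B + C) = derm i B + derm i C.
Proof. by apply/matrixP=> a b; rewrite !mxE derD. Qed.

Lemma dermN m q i (B : 'M[A]_(m, q)) : derm i (- B) = - derm i B.
Proof. by apply/matrixP=> a b; rewrite !mxE derN. Qed.

Lemma dermB m q i (B C : 'M[A]_(m, q)) : derm i (B - C) = derm i B - derm i C.
Proof. by rewrite dermD dermN. Qed.

Lemma dermT m q i (B : 'M[A]_(m, q)) : derm i B^T = (derm i B)^T.
Proof. by apply/matrixP=> a b; rewrite !mxE. Qed.

Lemma dermC m q i j (B : 'M[A]_(m, q)) : derm i (derm j B) = derm j (derm i B).
Proof. by apply/matrixP=> a b; rewrite !mxE derC. Qed.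

Lemma derm1 i m : derm i (1%:M : 'M[A]_m) = 0.
Proof.
by apply/matrixP=> a b; rewrite !mxE -(rmorph_nat (ccst A)) der_cst.
Qed.

Lemma grd_crd i : grd (crd A i) = delta_mx i 0.
Proof. by apply/matrixP=> a b; rewrite !mxE der_crd ord1 eqxx andbT. Qed.

End DRingTheory.

(** * Torsion-free connections and the Ricci identity *)

Section Connection.
Context {R : numFieldType} {n : nat} {A : diffRing R n}.
(* [(C i) k j] is Gamma^k_ij *)
Variable C : 'I_n -> 'M[A]_n.
Hypothesis C_sym : forall i j k, C i k j = C j k i.
Implicit Types (i j k l m : 'I_n) (X Y : 'cV[A]_n).

(** The commutator of the covariant derivatives along the i-th and j-th coordinate fields, as an
    endomorphism of vectors. *)
Definition curv i j : 'M[A]_n :=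
  derm i (C j) - derm j (C i) + C i *m C j - C j *m C i.

Definition nab X : 'M[A]_n := \matrix_(k, j) (derm j X + C j *m X) k 0.

Definition dvg X : A := \tr (nab X).

Definition ricm : 'M[A]_n := \matrix_(l, j) \sum_k curv k j k l.

Let N X j : 'cV[A]_n := derm j X + C j *m X.

Lemma nab_commute X k j :
  derm k (N X j) + C k *m N X j
  = derm j (N X k) + C j *m N X k + curv k j *m X.
Proof.
rewrite /N /curv !dermD !dermM (dermC k j) !mulmxDr !mulmxDl !mulNmx !mulmxA.
by apply/matrixP=> a b; rewrite !mxE; ring.
Qed.

(** This is div (nabla_Y X) = Y (div X) + tr (nabla X nabla Y) + Ric(X, Y): differentiate the
    product, commute the two derivatives of [X], and trace; the commutator contributes the Ricci
    term. Absence of torsion identifies the remaining Christoffel terms with those of nabla Y. *)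
Lemma ricci_identity X Y :
  dvg (nab X *m Y) = (Y^T *m grd (dvg X)) 0 0 + \tr (nab X *m nab Y)
                     + (X^T *m ricm *m Y) 0 0.
Proof.
have Ne k j : nab X k j = N X j k 0 by rewrite mxE.
have -> : dvg (nab X *m Y) = \sum_j \sum_k
    (Y j 0 * (derm k (N X j) + C k *m N X j) k 0 + nab X k j * der k (Y j 0)).
  rewrite exchange_big; apply: eq_bigr => k _; rewrite mxE 3!mxE der_sum.
  rewrite [X in _ + X]mxE; under [X in _ + X]eq_bigr do rewrite mxE mulr_sumr.
  rewrite exchange_big -big_split/=; apply: eq_bigr => j _.
  rewrite derM !Ne !mxE mulrDr mulr_sumr.
  under eq_bigr do rewrite Ne.
  have -> : \sum_i Y j 0 * (C k k i * N X j i 0) = \sum_i C k k i * (N X j i 0 *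
    Y j 0).
    by apply: eq_bigr => i _; ring.
  ring.
have -> : (X^T *m ricm *m Y) 0 0 = \sum_j \sum_k Y j 0 * (curv k j *m X) k 0.
  rewrite mxE; apply: eq_bigr => j _; rewrite mxE mulrC mulr_sumr.
  under eq_bigr do rewrite !mxE mulr_sumr mulr_sumr.
  rewrite exchange_big; apply: eq_bigr => k _; rewrite mxE mulr_sumr.
  by apply: eq_bigr => l _; ring.
have -> : (Y^T *m grd (dvg X)) 0 0 = \sum_j \sum_k Y j 0 * derm j (N X k) k 0.
  rewrite mxE; apply: eq_bigr => j _; rewrite !mxE der_sum mulr_sumr.
  by apply: eq_bigr => k _; rewrite Ne [derm j (N X k) _ _]mxE.
have -> : \tr (nab X *m nab Y) = \sum_j \sum_k
    (nab X k j * der k (Y j 0) + Y j 0 * (C j *m N X k) k 0).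
  rewrite exchange_big /mxtrace.
  under [LHS]eq_bigr do rewrite mxE.
  under [LHS]eq_bigr => k _ do under eq_bigr => j _ do
    rewrite [nab Y j k]mxE [X in _ * X]mxE mulrDr [derm _ _ _ _]mxE.
  under [LHS]eq_bigr do rewrite big_split.
  under [RHS]eq_bigr do rewrite big_split.
  rewrite !big_split/=; congr (_ + _).
  under [LHS]eq_bigr => k _ do under eq_bigr => j _ do rewrite [(_ *m _) _ _]mxE
    mulr_sumr.
  under [RHS]eq_bigr => k _ do under eq_bigr => j _ do rewrite [(_ *m _) _ _]mxE
    mulr_sumr.
  under [RHS]eq_bigr => j _ do rewrite exchange_big/=.
  rewrite [RHS]exchange_big/=; apply: eq_bigr => a _.
  apply: eq_bigr => c _; apply: eq_bigr => b _.
  by rewrite Ne (C_sym a); ring.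
rewrite -!big_split; apply: eq_bigr => j _; rewrite -!big_split/=.
by apply: eq_bigr => k _; rewrite nab_commute !mxE; ring.
Qed.

End Connection.

(* [gd] and [gu] hold the components g_ij and g^ij. *)
Record diffMetric (R : numFieldType) (n : nat) (A : diffRing R n) := DiffMetric {
  gd : 'M[A]_n ;
  gu : 'M[A]_n ;
  gd_sym : gd^T = gd ;
  gdu : gd *m gu = 1%:M
}.

(** * Levi-Civita calculus: Hessian, Laplacian and the Bochner formula *)

Section MetricTheory.
Context {R : numFieldType} {n : nat} {A : diffRing R n}.
Variable g : diffMetric A.
Local Notation G := (gd g).
Local Notation V := (gu g).
Implicit Types (f h u v w : A) (i j k l m : 'I_n) (X Y : 'cV[A]_n).

Lemma gud : V *m G = 1%:M.
Proof. exact: mulmx1C (gdu g). Qed.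

Lemma gu_sym : V^T = V.
Proof.
have e : V^T *m G = 1%:M by rewrite -(gd_sym g) -trmx_mul gdu trmx1.
by rewrite -[LHS]mulmx1 -(gdu g) mulmxA e mul1mx.
Qed.

Lemma gd_symE i j : G i j = G j i.
Proof. by rewrite -{1}(gd_sym g) mxE. Qed.

Definition chr k i j : A :=
  ccst A 2^-1 * \sum_l V k l *
    (der i (G j l) + der j (G i l) - der l (G i j)).

Definition chrm i : 'M[A]_n := \matrix_(k, j) chr k i j.

Lemma chr_sym k i j : chr k i j = chr k j i.
Proof.
by congr (_ * _); apply: eq_bigr => l _; rewrite (gd_symE i j); ring.
Qed.

Lemma chrm_sym i j k : chrm i k j = chrm j k i.
Proof. by rewrite !mxE chr_sym. Qed.

Lemma chr_lower m i j : (G *m chrm i) m j =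
  ccst A 2^-1 * (der i (G j m) + der j (G i m) - der m (G i j)).
Proof.
pose c := \col_l (der i (G j l) + der j (G i l) - der l (G i j)).
transitivity (ccst A 2^-1 * (G *m (V *m c)) m 0).
  rewrite 2!mxE mulr_sumr; apply: eq_bigr => k _; rewrite !mxE /chr.
  rewrite mulrCA; congr (_ * (_ * _)); apply: eq_bigr => l _.
  by rewrite !mxE.
by rewrite mulmxA gdu mul1mx mxE.
Qed.

(** Metric compatibility, nabla_i g = 0, in matrix form: in the sum of two lowered Christoffel
    symbols all derivatives but the i-th cancel. *)
Lemma derm_gd i : derm i G = (chrm i)^T *m G + G *m chrm i.
Proof.
have -> : (chrm i)^T *m G = (G *m chrm i)^T by rewrite trmx_mul gd_sym.
apply/matrixP=> a b.
rewrite mxE [RHS]mxE [X in X + _]mxE !chr_lower.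
rewrite (gd_symE i b) (gd_symE i a) (gd_symE b a).
by apply: mul2I; rewrite mulrDr !mulrA ![2 * ccst _ _]mulrC cst_half; ring.
Qed.

Lemma derm_gu i : derm i V = - (chrm i *m V + V *m (chrm i)^T).
Proof.
have e : derm i V *m G = - (V *m derm i G).
  by apply/eqP; rewrite -addr_eq0 -dermM gud derm1.
rewrite -[LHS]mulmx1 -(gdu g) mulmxA e derm_gd mulmxDr mulNmx mulmxDl.
by rewrite -!mulmxA gdu mulmx1 (mulmxA V G) gud mul1mx addrC.
Qed.

Definition hess f : 'M[A]_n :=
  \matrix_(i, j) (der i (der j f) - \sum_k chr k i j * der k f).

Definition lap f : A := \tr (V *m hess f).

(* [gr f h] is the pairing <df, dh>, [ip S T] the full contraction of two
   covariant 2-tensors, and [bil T f h] is T evaluated on the gradients. *)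
Definition gr f h : A := ((grd f)^T *m V *m grd h) 0 0.

Definition ip (S T : 'M[A]_n) : A := \tr (V *m S *m V *m T).

Definition ot f h : 'M[A]_n := grd f *m (grd h)^T.

Definition bil (T : 'M[A]_n) f h : A :=
  ((grd f)^T *m V *m T *m V *m grd h) 0 0.

(* Positive on round spheres: the opposite of [ricci]. *)
Definition ric : 'M[A]_n := ricm chrm.

Definition div X : A := dvg chrm X.

Lemma hess_sym f : (hess f)^T = hess f.
Proof.
apply/matrixP=> i j; rewrite !mxE derC; congr (_ - _).
by apply: eq_bigr => k _; rewrite chr_sym.
Qed.

Lemma hessE f k j : hess f k j = (derm j (grd f) - (chrm j)^T *m grd f) k 0.
Proof.
rewrite !mxE derC; congr (_ - _); apply: eq_bigr => m _.
by rewrite !mxE chr_sym.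
Qed.

(** The inverse metric is parallel, so raising an index commutes with covariant differentiation. *)
Lemma nab_gradient f : nab chrm (V *m grd f) = V *m hess f.
Proof.
apply/matrixP=> k j.
have -> : (V *m hess f) k j =
    (V *m (derm j (grd f) - (chrm j)^T *m grd f)) k 0.
  by rewrite mxE [RHS]mxE; apply: eq_bigr => m _; rewrite hessE.
rewrite mxE dermM derm_gu mulmxBr mulNmx mulmxDl !mulmxA.
by congr (fun_of_matrix _ _ _); rewrite opprD [LHS]addrC !addrA subrr add0r addrC.
Qed.

Lemma tr_scalar (B : 'M[A]_1) : B 0 0 = \tr B.
Proof. by rewrite /mxtrace big_ord1. Qed.

Lemma T_scalar (B : 'M[A]_1) : B 0 0 = B^T 0 0.
Proof. by rewrite mxE. Qed.

Lemma grC f h : gr f h = gr h f.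
Proof. by rewrite /gr T_scalar !trmx_mul gu_sym trmxK mulmxA. Qed.

Lemma grDl f h u : gr (f + h) u = gr f u + gr h u.
Proof. by rewrite /gr grdD linearD/= !mulmxDl mxE. Qed.

Lemma grMl f h u : gr (f * h) u = h * gr f u + f * gr h u.
Proof. by rewrite /gr grdM linearD/= !linearZ/= !mulmxDl -!scalemxAl !mxE. Qed.

Lemma grNl f h : gr (- f) h = - gr f h.
Proof.
have g0 : gr 0 h = 0 by apply: (addrI (gr 0 h)); rewrite -grDl !addr0.
by apply: (addrI (gr f h)); rewrite -grDl !subrr g0.
Qed.

Lemma grNr f h : gr f (- h) = - gr f h.
Proof. by rewrite !(grC f) grNl. Qed.

Lemma grDr f h u : gr u (f + h) = gr u f + gr u h.
Proof. by rewrite !(grC u) grDl. Qed.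

Lemma grMr f h u : gr u (f * h) = h * gr u f + f * gr u h.
Proof. by rewrite !(grC u) grMl. Qed.

(** The Leibniz rule for the pairing; as the inverse metric is parallel, only the covariant
    derivatives of df and dh remain, and these are the Hessians. *)
Lemma grd_gr f h :
  grd (gr f h) = hess f *m V *m grd h + hess h *m V *m grd f.
Proof.
apply/matrixP=> m z; rewrite (ord1 z) {z}.
have row_hess u : row m (hess u) = (derm m (grd u))^T - (grd u)^T *m chrm m.
  apply/matrixP=> a b; rewrite mxE -[hess u]hess_sym mxE hessE.
  rewrite -[in RHS](trmxK (chrm m)) -trmx_mul -linearB/=.
  by rewrite (ord1 a) [RHS]mxE.
have half u v : (hess u *m V *m grd v) m 0 =
    ((derm m (grd u))^T *m V *m grd v - (grd u)^T *m chrm m *m V *m grd v) 0 0.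
  by rewrite -!mulmxBl -row_hess -!row_mul [RHS]mxE.
rewrite [RHS]mxE !half /gr mxE.
have -> : der m (((grd f)^T *m V *m grd h) 0 0) =
    derm m ((grd f)^T *m V *m grd h) 0 0 by rewrite [RHS]mxE.
rewrite !dermM derm_gu dermT.
have -> : ((derm m (grd h))^T *m V *m grd f - (grd h)^T *m chrm m *m V *m grd f) 0 0
  = ((grd f)^T *m V *m derm m (grd h) - (grd f)^T *m V *m (chrm m)^T *m grd h) 0 0.
  rewrite T_scalar !(trmxDE, trmxNE) !trmx_mul gu_sym !trmxK !mulmxA.
  by [].
rewrite mulmxN mulmxDr !mulmxDl mulNmx mulmxDl !mulmxA !mxE; ring.
Qed.

Lemma ip_ot (T : 'M[A]_n) f h : ip T (ot f h) = bil T h f.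
Proof.
by rewrite /ip /ot /bil mulmxA mxtrace_mulC !mulmxA -tr_scalar.
Qed.

Lemma bilC (T : 'M[A]_n) f h : T^T = T -> bil T f h = bil T h f.
Proof.
move=> Ts; rewrite /bil T_scalar !trmx_mul gu_sym Ts trmxK !mulmxA.
by [].
Qed.

Lemma gr_gr f h u : gr u (gr f h) = bil (hess f) u h + bil (hess h) u f.
Proof. by rewrite {1}/gr grd_gr mulmxDr mxE /bil !mulmxA. Qed.

Lemma gr_grl f h u : gr (gr f h) u = bil (hess f) u h + bil (hess h) u f.
Proof. by rewrite grC gr_gr. Qed.

(** The Koszul formula for gradient fields: in the three permutations of the Leibniz rule the
    Hessians of [h] and [u] cancel by symmetry. *)
Lemma hess_gr f h u :
  2 * bil (hess f) h u = gr h (gr f u) + gr u (gr f h) - gr f (gr h u).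
Proof.
rewrite !gr_gr (bilC u h (hess_sym f)) (bilC h f (hess_sym u)).
by rewrite (bilC u f (hess_sym h)); ring.
Qed.

Lemma lap_div f : lap f = div (V *m grd f).
Proof. by rewrite /div /dvg nab_gradient. Qed.

(** The Ricci identity for the gradients of [f] and [h]. *)
Lemma div_hess f h :
  div (V *m hess f *m V *m grd h) =
  gr (lap f) h + ip (hess f) (hess h) + bil ric f h.
Proof.
rewrite -nab_gradient -!mulmxA /div ricci_identity; last exact: chrm_sym.
rewrite -/(div _) -lap_div !nab_gradient !trmx_mul gu_sym !mulmxA.
by rewrite -/(gr h _) grC.
Qed.

Lemma divD X Y : div (X + Y) = div X + div Y.
Proof.
rewrite /div /dvg -mxtraceD; congr (\tr _); apply/matrixP=> i j.
by rewrite [LHS]mxE dermD mulmxDr !mxE; ring.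
Qed.

Lemma divN X : div (- X) = - div X.
Proof.
have d0 : div 0 = 0 by apply: (addrI (div 0)); rewrite -divD !addr0.
by apply: (addrI (div X)); rewrite -divD !subrr d0.
Qed.

(** The divergence of the gradient of <df, dh>, each of its two terms being given by [div_hess].
    Both orders of the Ricci term occur, since its symmetry is established only below. *)
Lemma bochner f h : lap (gr f h) =
  gr (lap f) h + gr f (lap h) + 2 * ip (hess f) (hess h)
  + bil ric f h + bil ric h f.
Proof.
rewrite lap_div grd_gr mulmxDr divD !mulmxA !div_hess (grC (lap h)).
have -> : ip (hess h) (hess f) = ip (hess f) (hess h).
  by rewrite /ip -mulmxA mxtrace_mulC !mulmxA.
ring.
Qed.

(** * Symmetries of the curvature and the Bianchi identities *)

Local Notation C := chrm.
Local Notation F := (curv chrm).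
Let K i j : 'M[A]_n := F i j *m V.

Lemma curvN i j : F i j = - F j i.
Proof. by apply/matrixP=> a b; rewrite /curv !mxE; ring. Qed.

(** Second derivatives of the inverse metric commute; expressing them through its parallelism, their
    difference is the curvature acting on both indices. *)
Lemma curv_gu_skew i j : (F i j *m V)^T = - (F i j *m V).
Proof.
apply/eqP; rewrite -addr_eq0 addrC; apply/eqP.
have := dermC i j V; rewrite !derm_gu !dermN !dermD !dermM !derm_gu !dermT.
move/eqP; rewrite -subr_eq0 => /eqP e.
rewrite trmx_mul gu_sym /curv !(trmxDE, trmxNE) !trmx_mul -[RHS]oppr0 -[in RHS]e.
rewrite !(mulNmx, mulmxN, mulmxDl, mulmxDr) !mulmxA.
by apply/matrixP=> a b; rewrite !mxE; ring.
Qed.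

Lemma tr_curv i j : \tr (F i j) = 0.
Proof.
have e : F i j = F i j *m V *m G by rewrite -mulmxA gud mulmx1.
apply: mul2I; rewrite mulr0 mulr_natl mulr2n {1}e -mxtrace_tr trmx_mul curv_gu_skew.
by rewrite gd_sym mulmxN linearN/= mxtrace_mulC -e addNr.
Qed.

Lemma bianchi1 i j l k : F i j k l + F j l k i + F l i k j = 0.
Proof.
have e a b c : \sum_m C a k m * C b m c = \sum_m C a k m * C c m b.
  by apply: eq_bigr => m _; rewrite (chrm_sym b).
have eF a b c : F a b k c = der a (C b k c) - der b (C a k c)
    + \sum_m C a k m * C b m c - \sum_m C b k m * C a m c.
  by rewrite /curv !(mxDE, mxNE, mxME, dermE).
rewrite !eF (e i j) (e j l) (e l i).
rewrite (chrm_sym j l k) (chrm_sym i l k) (chrm_sym j i k).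
ring.
Qed.

(** Contracting the first Bianchi identity shows that the skew part of Ric is, up to sign, a trace
    of the curvature endomorphism, and that trace vanishes because the endomorphism is skew for the
    metric. *)
Lemma ric_sym : ric^T = ric.
Proof.
apply/matrixP=> j l; rewrite !mxE; apply/eqP; rewrite -subr_eq0 -sumrB.
apply/eqP; transitivity (- \tr (F j l)); last by rewrite tr_curv oppr0.
rewrite /mxtrace -sumrN; apply: eq_bigr => k _.
have := bianchi1 k j l k; rewrite (curvN l k) [(- F k l) _ _]mxE => /eqP.
by rewrite -addrA addrCA addrC addr_eq0 => /eqP.
Qed.

(** The Jacobi identity for the three covariant derivatives along coordinate fields. *)
Lemma bianchi2 i j k :
  derm i (F j k) + C i *m F j k - F j k *m C i
  + (derm j (F k i) + C j *m F k i - F k i *m C j)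
  + (derm k (F i j) + C k *m F i j - F i j *m C k) = 0.
Proof.
rewrite /curv !(dermD, dermB, dermN, dermM).
rewrite (dermC j i) (dermC k i) (dermC k j).
rewrite !(mulNmx, mulmxN, mulmxBl, mulmxBr, mulmxDl, mulmxDr) !mulmxA.
by apply/matrixP=> a b; rewrite !mxE; ring.
Qed.

Definition ricmix : 'M[A]_n := V *m ric.

Definition scal : A := \tr ricmix.

(** Covariant derivative with respect to the two matrix indices only: the Christoffel terms of the
    form indices j and k cancel in the cyclic sum. *)
Let E i j k : 'M[A]_n := derm i (K j k) + C i *m K j k + K j k *m (C i)^T.

Lemma bianchi2_gu i j k : E i j k + E j k i + E k i j = 0.
Proof.
have e a b c : E a b c = (derm a (F b c) + C a *m F b c - F b c *m C a) *m V.
  rewrite /E /K; move: (F b c) => B.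
  rewrite dermM derm_gu mulmxN mulmxDr !mulmxDl mulNmx !mulmxA.
  by apply/matrixP=> x y; rewrite !(mxDE, mxNE); ring.
by rewrite !e -!mulmxDl bianchi2 mul0mx.
Qed.

Lemma curv_guN i j k m : K i j k m = K j i m k.
Proof.
transitivity ((K j i)^T k m); last exact: mxE.
by rewrite curv_gu_skew -mulNmx -curvN.
Qed.

Lemma ricmixE m j : ricmix m j = \sum_k K k j k m.
Proof.
rewrite mxME; under eq_bigr do rewrite [ric _ _]mxE mulr_sumr.
rewrite exchange_big/=; apply: eq_bigr => k _; rewrite mxME.
apply: eq_bigr => l _; rewrite mulrC; congr (_ * _).
by rewrite -[in LHS]gu_sym mxE.
Qed.

(** The factor after 2 is nabla_m R^m_j: the trace with [C j] is the Christoffel term of the lower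
    index. The formula is the double trace of the second Bianchi identity. *)
Lemma bianchi_contracted j :
  2 * (\sum_m (derm m ricmix + C m *m ricmix) m j - \tr (C j *m ricmix))
  = der j scal.
Proof.
have EE a b c k m : E a b c k m = der a (K b c k m)
    + \sum_l C a k l * K b c l m + \sum_l K b c k l * C a m l.
  rewrite /E; move: (K b c) => B; rewrite !mxDE !mxME dermE; congr (_ + _).
  by apply: eq_bigr => l _; rewrite [_^T _ _]mxE.
have EN a b c k m : E a b c k m = E a c b m k.
  rewrite !EE curv_guN -!addrA; congr (_ + _).
  have S x y : \sum_l K b c x l * C a y l = \sum_l C a y l * K c b l x.
    by apply: eq_bigr => l _; rewrite curv_guN mulrC.
  have S' x y : \sum_l C a x l * K b c l y = \sum_l K c b y l * C a x l.
    by apply: eq_bigr => l _; rewrite curv_guN mulrC.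
  by rewrite S S' addrC.
(* Of the three cyclic terms two coincide by the skewness in both pairs of indices, and the third is
   the opposite of the full trace. *)
have main : 2 * (\sum_k \sum_m E m k j k m) = \sum_k \sum_m E j k m k m.
  have : \sum_k \sum_m (E m k j k m + E k j m k m + E j m k k m) = 0.
    apply: big1 => k _; apply: big1 => m _.
    have := congr1 (fun B : 'M[A]_n => B k m) (bianchi2_gu m k j).
    by rewrite [LHS]mxDE [X in X + _ = _]mxDE [RHS]mxE.
  under eq_bigr do rewrite !big_split/=.
  rewrite !big_split/=.
  have -> : \sum_k \sum_m E k j m k m = \sum_k \sum_m E m k j k m.
    rewrite exchange_big/=; apply: eq_bigr => k _; apply: eq_bigr => m _.
    by rewrite EN.
  have -> : \sum_k \sum_m E j m k k m = - \sum_k \sum_m E j k m k m.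
    rewrite -sumrN; apply: eq_bigr => k _; rewrite -sumrN.
    apply: eq_bigr => m _; rewrite !EE.
    have KN x y : K m k x y = - K k m x y by rewrite /K curvN mulNmx mxNE.
    under eq_bigr do rewrite KN mulrN.
    under [X in _ + _ + X]eq_bigr do rewrite KN mulNr.
    by rewrite KN derN !sumrN; ring.
  move=> /eqP; rewrite subr_eq0 => /eqP <-; ring.
(* The full trace also contracts the form indices, which [E] leaves uncorrected; the Christoffel
   terms that survive are exactly those subtracted in the statement. *)
have eS : \sum_k \sum_m E j k m k m = der j scal + 2 * \tr (C j *m ricmix).
  under [LHS]eq_bigr do under eq_bigr do rewrite EE.
  under [LHS]eq_bigr do rewrite !big_split/=.
  rewrite !big_split/=.
  have -> : \sum_k \sum_m der j (K k m k m) = der j scal.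
    rewrite exchange_big /scal /mxtrace der_sum; apply: eq_bigr => m _.
    by rewrite ricmixE der_sum.
  have -> : \sum_k \sum_m \sum_l C j k l * K k m l m = \tr (C j *m ricmix).
    apply: eq_bigr => k _; rewrite mxME exchange_big/=; apply: eq_bigr => l _.
    by rewrite ricmixE -mulr_sumr; congr (_ * _); apply: eq_bigr => m _;
      rewrite curv_guN.
  have -> : \sum_k \sum_m \sum_l K k m k l * C j m l = \tr (C j *m ricmix).
    rewrite exchange_big; apply: eq_bigr => m _; rewrite mxME exchange_big/=.
    apply: eq_bigr => l _; rewrite ricmixE mulr_sumr; apply: eq_bigr => k _.
    by rewrite mulrC.
  ring.
have eT : \sum_k \sum_m E m k j k m = \sum_m (derm m ricmix + C m *m ricmix) m j.
  rewrite exchange_big; under [LHS]eq_bigr do under eq_bigr do rewrite EE.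
  under [LHS]eq_bigr do rewrite !big_split/=.
  (* A Christoffel symbol, symmetric in l and m, against a curvature skew in l and m. *)
  have sk k : \sum_m \sum_l C m k l * K k j l m = 0.
    apply: mul2I; rewrite mulr0 mulr_natl mulr2n {1}exchange_big/=.
    rewrite -big_split big1// => l _; rewrite -big_split big1// => m _ /=.
    by rewrite curv_guN {1}/K curvN mulNmx mxNE chrm_sym mulrN addNr.
  rewrite !big_split/=.
  have -> : \sum_m \sum_k \sum_l C m k l * K k j l m = 0.
    by rewrite exchange_big big1// => k _; rewrite sk.
  rewrite addr0 -big_split; apply: eq_bigr => m _ /=.
  rewrite [RHS]mxDE dermE [X in _ = _ + X]mxME ricmixE der_sum; congr (_ + _).
  rewrite exchange_big; apply: eq_bigr => l _; rewrite ricmixE mulr_sumr.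
  by apply: eq_bigr => k _; rewrite mulrC.
by rewrite mulrBr -eT main eS; ring.
Qed.

(** The divergence of Ric contracted with grad f. The derivative of Ric contributes half the
    gradient of the scalar curvature by the contracted Bianchi identity; this removes the divergence
    of Ric from the operator. *)
Lemma div_ric f :
  div (ricmix *m V *m grd f) = ip ric (hess f) + ccst A 2^-1 * gr scal f.
Proof.
rewrite -mulmxA; set X := V *m grd f.
have -> : div (ricmix *m X) = \sum_j X j 0 *
   (\sum_m (derm m ricmix + C m *m ricmix) m j)
   + \sum_m \sum_j ricmix m j * der m (X j 0).
  under eq_bigr do rewrite mulr_sumr.
  rewrite exchange_big -big_split; apply: eq_bigr => m _ /=.
  rewrite [LHS]mxE dermM mulmxA addrAC -mulmxDl [LHS]mxDE !mxME.
  congr (_ + _); apply: eq_bigr => l _; first exact: mulrC.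
  by rewrite dermE.
have -> : ip ric (hess f) = \sum_m \sum_l ricmix m l * der m (X l 0)
    + \sum_j X j 0 * \tr (C j *m ricmix).
  rewrite /ip -[V *m ric]/ricmix -mulmxA -nab_gradient -/X.
  under [X in _ = _ + X]eq_bigr => i _ do
    rewrite mxtrace_mulC /mxtrace mulr_sumr.
  rewrite [X in _ = _ + X]exchange_big -big_split; apply: eq_bigr => m _ /=.
  rewrite mxME.
  under [LHS]eq_bigr => l _ do rewrite [nab _ _ _ _]mxE mxDE dermE [(_ *m X) _
    _]mxME mulrDr mulr_sumr.
  rewrite big_split; congr (_ + _) => /=.
  rewrite exchange_big; apply: eq_bigr => k _ /=.
  rewrite [X in _ = _ * X]mxME mulr_sumr; apply: eq_bigr => l _.
  by rewrite chrm_sym; ring.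
have -> : gr scal f = \sum_j X j 0 * der j scal.
  rewrite /gr -mulmxA -/X mxME; apply: eq_bigr => j _.
  by rewrite [_^T _ _]mxE [grd _ _ _]mxE mulrC.
have e j : der j scal = 2 * (\sum_m (derm m ricmix + C m *m ricmix) m j)
  - 2 * \tr (C j *m ricmix) by rewrite -bianchi_contracted mulrBr.
under [X in _ = _ + _ * X]eq_bigr do rewrite e -mulrBr mulrCA.
rewrite -mulr_sumr mulrA cst_half mul1r.
under [X in _ = _ + X]eq_bigr do rewrite mulrBr.
by rewrite sumrB; ring.
Qed.

(** * Leibniz rules and linearity of the contractions *)

Lemma hessD f h : hess (f + h) = hess f + hess h.
Proof.
apply/matrixP=> i j; rewrite !mxE !derD.
under eq_bigr do rewrite derD mulrDr.
by rewrite big_split/=; ring.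
Qed.

Lemma hessM f h :
  hess (f * h) = h *: hess f + f *: hess h + ot f h + ot h f.
Proof.
apply/matrixP=> i j; rewrite !mxE !big_ord1 !mxE !(derM, derD).
under eq_bigr do rewrite derM mulrDr !mulrA.
rewrite big_split/= !mulrBr !mulr_sumr.
rewrite (eq_bigr (fun k => h * (chr k i j * der k f))); last by move=> k _; ring.
rewrite [X in _ - (_ + X)](eq_bigr (fun k => f * (chr k i j * der k h)));
  first by ring.
by move=> k _; ring.
Qed.

(** [B] stands for e^(c w) with c constant, characterised by dB = c B dw. *)
Lemma hess_exp (w B c : A) : (forall i, der i c = 0) ->
  (forall i, der i B = c * B * der i w) ->
  hess B = (c * B) *: hess w + (c ^+ 2 * B) *: ot w w.
Proof.
move=> c0 dB; apply/matrixP=> i j; rewrite !mxE big_ord1 !mxE dB !derM c0 !dB.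
under eq_bigr do rewrite dB mulrCA.
by rewrite -mulr_sumr; ring.
Qed.

Lemma lapE f : lap f = \tr (V *m hess f). Proof. by []. Qed.

Lemma tr_ot f h : \tr (V *m ot f h) = gr f h.
Proof. by rewrite /ot mulmxA mxtrace_mulC mulmxA -tr_scalar -/(gr h f) grC. Qed.

Lemma trgD S T : \tr (V *m (S + T)) = \tr (V *m S) + \tr (V *m T).
Proof. by rewrite mulmxDr mxtraceD. Qed.

Lemma trgZ (a : A) S : \tr (V *m (a *: S)) = a * \tr (V *m S).
Proof. by rewrite -scalemxAr mxtraceZ. Qed.

Lemma trgN S : \tr (V *m - S) = - \tr (V *m S).
Proof. by rewrite -scaleN1r trgZ mulN1r. Qed.

Lemma lapD f h : lap (f + h) = lap f + lap h.
Proof. by rewrite /lap hessD mulmxDr mxtraceD. Qed.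

Lemma lapN f : lap (- f) = - lap f.
Proof.
have l0 : lap 0 = 0 by apply: (addrI (lap 0)); rewrite -lapD !addr0.
by apply: (addrI (lap f)); rewrite -lapD !subrr l0.
Qed.

Lemma lapM f h : lap (f * h) = h * lap f + f * lap h + 2 * gr f h.
Proof.
rewrite /lap hessM !mulmxDr !mxtraceD -!scalemxAr !mxtraceZ !tr_ot (grC h).
ring.
Qed.

Lemma lap_exp (w B c : A) : (forall i, der i c = 0) ->
  (forall i, der i B = c * B * der i w) ->
  lap B = c * B * lap w + c ^+ 2 * B * gr w w.
Proof.
move=> c0 dB; rewrite /lap (hess_exp c0 dB) mulmxDr mxtraceD -!scalemxAr.
by rewrite !mxtraceZ tr_ot.
Qed.

Lemma gr_exp (w B c f : A) :
  (forall i, der i B = c * B * der i w) -> gr B f = c * B * gr w f.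
Proof.
move=> dB; rewrite /gr; have -> : grd B = (c * B) *: grd w.
  by apply/matrixP=> i j; rewrite !mxE dB.
by rewrite linearZ/= -!scalemxAl mxE.
Qed.

Lemma gr_cst (c f : A) : (forall i, der i c = 0) -> gr c f = 0.
Proof.
move=> c0; rewrite /gr; have -> : grd c = 0.
  by apply/matrixP=> i j; rewrite !mxE c0.
by rewrite trmx0 !mul0mx mxE.
Qed.

Lemma hess_cst (c : A) : (forall i, der i c = 0) -> hess c = 0.
Proof.
move=> c0; apply/matrixP=> i j; rewrite !mxE !c0 big1 ?subr0//.
  by rewrite der0.
by move=> k _; rewrite c0 mulr0.
Qed.

Lemma lap_cst (c : A) : (forall i, der i c = 0) -> lap c = 0.
Proof. by move=> c0; rewrite /lap hess_cst// mulmx0 mxtrace0. Qed.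

Lemma gr_cstM (c f h : A) : (forall i, der i c = 0) -> gr (c * f) h = c * gr f h.
Proof. by move=> c0; rewrite grMl (gr_cst _ c0); ring. Qed.

Lemma lap_cstM (c f : A) : (forall i, der i c = 0) -> lap (c * f) = c * lap f.
Proof. by move=> c0; rewrite lapM (gr_cst _ c0) (lap_cst c0); ring. Qed.

Lemma ipC S T : ip S T = ip T S.
Proof. by rewrite /ip -mulmxA mxtrace_mulC !mulmxA. Qed.

Lemma ipDl S T U : ip (S + T) U = ip S U + ip T U.
Proof. by rewrite /ip mulmxDr !mulmxDl mxtraceD. Qed.

Lemma ipZl (a : A) S T : ip (a *: S) T = a * ip S T.
Proof. by rewrite /ip -scalemxAr -!scalemxAl mxtraceZ. Qed.

Lemma ipNl S T : ip (- S) T = - ip S T.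
Proof. by rewrite -scaleN1r ipZl mulN1r. Qed.

Lemma ipDr S T U : ip U (S + T) = ip U S + ip U T.
Proof. by rewrite !(ipC U) ipDl. Qed.

Lemma ipZr (a : A) S T : ip T (a *: S) = a * ip T S.
Proof. by rewrite !(ipC T) ipZl. Qed.

Lemma ipNr S T : ip T (- S) = - ip T S.
Proof. by rewrite !(ipC T) ipNl. Qed.

Lemma ip_gdl T : ip G T = \tr (V *m T).
Proof. by rewrite /ip gud mul1mx. Qed.

Lemma ip_gdr T : ip T G = \tr (V *m T).
Proof. by rewrite ipC ip_gdl. Qed.

Lemma tr_gd : \tr (V *m G) = n%:R.
Proof. by rewrite gud mxtrace1. Qed.

Lemma bilD S T f h : bil (S + T) f h = bil S f h + bil T f h.
Proof. by rewrite -!ip_ot ipDl. Qed.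

Lemma bilN T f h : bil (- T) f h = - bil T f h.
Proof. by rewrite -!ip_ot ipNl. Qed.

Lemma bilZ (a : A) T f h : bil (a *: T) f h = a * bil T f h.
Proof. by rewrite -!ip_ot ipZl. Qed.

Lemma bil_gd f h : bil G f h = gr f h.
Proof. by rewrite -ip_ot ip_gdl tr_ot grC. Qed.

Lemma bil_ot u v f h : bil (ot u v) f h = gr f u * gr v h.
Proof.
rewrite /bil /ot -!mulmxA !mulmxA -(mulmxA _ V) -(mulmxA _ _ (V *m _)) mxME
  big_ord1.
by rewrite mulmxA.
Qed.

Lemma ip_otl T f h : ip (ot f h) T = bil T h f.
Proof. by rewrite ipC ip_ot. Qed.

Lemma divZ (s : A) X : div (s *: X) = s * div X + ((grd s)^T *m X) 0 0.
Proof.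
rewrite /div /dvg /mxtrace mulr_sumr mxME -big_split; apply: eq_bigr => k _ /=.
rewrite [nab _ _ _ _]mxE [nab _ _ _ _]mxE -scalemxAr !mxDE dermE !mxE derM; ring.
Qed.

Lemma div_grad (s f : A) : div (s *: (V *m grd f)) = s * lap f + gr s f.
Proof. by rewrite divZ -lap_div /gr mulmxA. Qed.

(** * The operator in terms of the Ricci and of the Schouten tensor *)

Definition schouten_tr : A := ccst A (2 * (n%:R - 1))^-1 * scal.

Definition schouten : 'M[A]_n := ccst A (n%:R - 2)^-1 *: (ric - schouten_tr *: G).

Definition conf_weight : A := ccst A ((n%:R - 4) / 2).

Definition paneitz_schouten f : A :=
  lap (lap f) + 4 * (ip schouten (hess f) + gr schouten_tr f)
  - (n%:R - 2) * (schouten_tr * lap f + gr schouten_tr f)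
  + conf_weight * (- lap schouten_tr - 2 * ip schouten schouten + (conf_weight +
    2) * schouten_tr ^+ 2) * f.

(** The operator of the statement with the usual curvature signs: terms linear in the curvature are
    negated, quadratic ones are unchanged. *)
Definition paneitz_ric f : A :=
  lap (lap f)
  + div (ccst A (4 / (n%:R - 2)) *: (ricmix *m V *m grd f)
         - (ccst A ((n%:R ^+ 2 - 4 * n%:R + 8)
                   / (2 * (n%:R - 1) * (n%:R - 2))) * scal) *: (V *m grd f))
  + (- ccst A ((n%:R - 4) / (4 * (n%:R - 1))) * lap scal
     - ccst A ((n%:R - 4) / (n%:R - 2) ^+ 2) * ip ric ric
     + ccst A ((n%:R - 4) * (n%:R ^+ 3 - 4 * n%:R ^+ 2 + 16 * n%:R - 16)
       / (16 * (n%:R - 1) ^+ 2 * (n%:R - 2) ^+ 2)) * scal ^+ 2) * f.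

Lemma conf_weightE : n%:R = 2 * conf_weight + 4 :> A.
Proof.
rewrite /conf_weight -(rmorph_nat (ccst A) n) -(rmorph_nat (ccst A) 2) -rmorphM.
by rewrite -(rmorph_nat (ccst A) 4) -rmorphD; congr (ccst A _); field.
Qed.

Hypothesis n_gt2 : (2 < n)%N.

Lemma nB2_neq0 : (n%:R - 2 : R) != 0.
Proof. by rewrite subr_eq0 eqr_nat gtn_eqF. Qed.

Lemma nB1_neq0 : (n%:R - 1 : R) != 0.
Proof. by rewrite subr_eq0 (eqr_nat _ n 1) gtn_eqF// (ltn_trans _ n_gt2). Qed.

Lemma scalE : scal = 2 * (n%:R - 1) * schouten_tr.
Proof.
rewrite /schouten_tr -(rmorph_nat (ccst A) n) -(rmorph_nat (ccst A) 2).
rewrite -(rmorph1 (ccst A)) -rmorphB -rmorphM mulrA -rmorphM mulfV ?rmorph1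
  ?mul1r//.
by rewrite mulf_neq0 ?pnatr_eq0 ?nB1_neq0.
Qed.

Lemma ricE : ric = (n%:R - 2) *: schouten + schouten_tr *: G.
Proof.
rewrite /schouten -(rmorph_nat (ccst A) n) -(rmorph_nat (ccst A) 2).
rewrite -rmorphB scalerA -rmorphM mulfV ?nB2_neq0// rmorph1 scale1r.
by rewrite subrK.
Qed.

Lemma tr_schouten : \tr (V *m schouten) = schouten_tr.
Proof.
rewrite -scalemxAr mxtraceZ mulmxBr linearB/= -/ricmix -/scal -scalemxAr.
rewrite mxtraceZ tr_gd scalE.
rewrite (_ : _ - _ = (n%:R - 2) * schouten_tr); last by ring.
rewrite -(rmorph_nat (ccst A) n) -(rmorph_nat (ccst A) 2) -rmorphB mulrA.
by rewrite -rmorphM mulVf ?nB2_neq0// rmorph1 mul1r.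
Qed.

Lemma schouten_sym : schouten^T = schouten.
Proof. by rewrite /schouten linearZ/= linearB/= linearZ/= ric_sym gd_sym. Qed.

Lemma paneitz_ric_schouten f : paneitz_ric f = paneitz_schouten f.
Proof.
rewrite /paneitz_ric /paneitz_schouten divD divN divZ.
have gr0 c X : ((grd (ccst A c))^T *m X) 0 0 = 0.
  have -> : grd (ccst A c) = 0 by apply/matrixP=> i j; rewrite !mxE der_cst.
  by rewrite trmx0 mul0mx mxE.
rewrite gr0 div_ric div_grad scalE.
have rE := ricE; have tP := tr_schouten; move: rE tP.
move: schouten schouten_tr => P j rE tP; rewrite rE.
rewrite !(ipDl, ipDr, ipZl, ipZr, ip_gdl, ip_gdr) !(mulmxDr, =^~ scalemxAr).
rewrite -/(lap f) !mxtraceD !mxtraceZ tP tr_gd.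
have ccst0 c i : der i (ccst A c) = 0 by rewrite der_cst.
have d0 i : der i (2 * (n%:R - 1) : A) = 0.
  by rewrite -(rmorph_nat (ccst A) n) -(rmorph_nat (ccst A) 2)
    -(rmorph1 (ccst A)) -rmorphB -rmorphM.
rewrite !(gr_cstM _ _ (ccst0 _)) !(gr_cstM _ _ d0) !(lap_cstM _ d0).
rewrite /conf_weight -(rmorph_nat (ccst A) n).
move: (n%:R : R) nB1_neq0 nB2_neq0 => N N1 N2.
have N3 : N - 4 = (N - 2) - 2 by ring.
(* Coefficients are gathered inside [ccst], where they are fractions in n that [field] can simplify.
   The term 3 N - 4 comes from <Ric, Ric> = (n - 2)^2 <P, P> + (2 (n - 2) + n) J^2. *)
pose k2 := (N ^+ 2 - 4 * N + 8) / (2 * (N - 1) * (N - 2)).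
pose c5 := (N - 4) * (N ^+ 3 - 4 * N ^+ 2 + 16 * N - 16)
    / (16 * (N - 1) ^+ 2 * (N - 2) ^+ 2).
transitivity (lap (lap f) + ccst A (4 / (N - 2) * (N - 2)) * ip P (hess f)
  + ccst A (4 / (N - 2) - k2 * (2 * (N - 1))) * (j * lap f)
  + ccst A (4 / (N - 2) * 2^-1 * (2 * (N - 1)) - k2 * (2 * (N - 1))) * gr j f
  + (- ccst A ((N - 4) / (4 * (N - 1)) * (2 * (N - 1))) * lap j
     - ccst A ((N - 4) / (N - 2) ^+ 2 * (N - 2) ^+ 2) * ip P P
     + ccst A (c5 * (2 * (N - 1)) ^+ 2
         - (N - 4) / (N - 2) ^+ 2 * (3 * N - 4)) * j ^+ 2) * f).
  by rewrite !(rmorphB, rmorphM, rmorphXn) !rmorph_nat; ring.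
have -> : 4 / (N - 2) * (N - 2) = 4 by field.
have -> : 4 / (N - 2) - k2 * (2 * (N - 1)) = - (N - 2).
  by rewrite /k2; field; rewrite N1 N2.
have -> : 4 / (N - 2) * 2^-1 * (2 * (N - 1)) - k2 * (2 * (N - 1)) = 6 - N.
  by rewrite /k2; field; rewrite N1 N2.
have -> : (N - 4) / (4 * (N - 1)) * (2 * (N - 1)) = (N - 4) / 2.
  by field; rewrite N1.
have -> : (N - 4) / (N - 2) ^+ 2 * (N - 2) ^+ 2 = 2 * ((N - 4) / 2).
  by field; rewrite N2.
have -> : c5 * (2 * (N - 1)) ^+ 2 - (N - 4) / (N - 2) ^+ 2 * (3 * N - 4)
    = (N - 4) / 2 * ((N - 4) / 2 + 2).
  by rewrite /c5; field; rewrite N1 N2.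
  by ring.
Qed.

(** * Index sums matching the coordinate definitions *)

Lemma ric_chr i j : ric i j =
  \sum_k (der k (chr k i j) - der j (chr k i k))
  + \sum_k \sum_l (chr k k l * chr l i j - chr k j l * chr l i k).
Proof.
rewrite mxE -big_split; apply: eq_bigr => k _ /=.
have CE a b c : C a b c = chr b a c by rewrite mxE.
rewrite /curv !(mxDE, mxNE, mxME) !dermE !CE sumrB addrA (chr_sym k j i).
rewrite (chr_sym k k i); congr (_ - _ + _ - _).
  by apply: eq_bigr => l _; rewrite !CE (chr_sym l i j).
by apply: eq_bigr => l _; rewrite !CE (chr_sym l i k).
Qed.

Lemma lap_sum f : lap f =
  \sum_i \sum_j V i j * (der i (der j f) - \sum_k chr k i j * der k f).
Proof.
rewrite /lap /mxtrace; apply: eq_bigr => i _; rewrite mxE.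
by apply: eq_bigr => j _; rewrite -[hess f]hess_sym !mxE.
Qed.

Lemma ric_up_sum i j :
  \sum_k \sum_l V i k * V j l * - ric k l = - (ricmix *m V) j i.
Proof.
rewrite mxE -sumrN; apply: eq_bigr => k _.
rewrite mxE mulr_suml -sumrN; apply: eq_bigr => l _.
have -> : V k i = V i k by rewrite -[in LHS]gu_sym mxE.
have -> : ric l k = ric k l by rewrite -[in LHS]ric_sym mxE.
by ring.
Qed.

Lemma scal_sum : \sum_i \sum_j V i j * - ric i j = - scal.
Proof.
rewrite /scal /mxtrace -sumrN; apply: eq_bigr => i _; rewrite mxE -sumrN.
apply: eq_bigr => j _; have -> : ric j i = ric i j by rewrite -[in LHS]ric_sym mxE.
by ring.
Qed.

Lemma ip_ric_sum :
  \sum_i \sum_j - (ricmix *m V) j i * - ric i j = ip ric ric.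
Proof.
rewrite /ip /mxtrace exchange_big; apply: eq_bigr => j _; rewrite [RHS]mxE.
by apply: eq_bigr => i _; rewrite mulrNN.
Qed.

Lemma div_sum X : div X = \sum_j (der j (X j 0) + \sum_k chr j j k * X k 0).
Proof.
apply: eq_bigr => j _; rewrite mxE mxDE mxE mxME; congr (_ + _).
by apply: eq_bigr => k _; rewrite mxE.
Qed.

Lemma paneitz_vec (a b : A) f j :
  \sum_i (- a * - (ricmix *m V) j i + b * (V i j * - scal)) * der i f
  = (a *: (ricmix *m V *m grd f) - (b * scal) *: (V *m grd f)) j 0.
Proof.
move: (ricmix *m V) (scal) => W r.
rewrite mxDE mxNE !mxZE !mxME !mulr_sumr -sumrB; apply: eq_bigr => i _.
have -> : V i j = V j i by rewrite -[in LHS]gu_sym mxE.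
by rewrite [grd f _ _]mxE; ring.
Qed.

End MetricTheory.

(** * Conformal maps between differential rings *)

Section ConformalMap.
Context {R : numFieldType} {n : nat} {A B : diffRing R n}.
Variables (g : diffMetric A) (k : diffMetric B) (th : {rmorphism A -> B}).
Variables (J : 'M[B]_n) (w E F : B).
Hypothesis th_cst : forall c, th (ccst A c) = ccst B c.
Hypothesis th_grd : forall f, grd (th f) = J *m map_mx th (grd f).
Hypothesis EF : E * F = 1.
Hypothesis derE : forall i, der i E = - 2 * E * der i w.
(** [th] models composition with a map of Jacobian [J], and [pullb] the pullback of covariant
    2-tensors along it. [E] and [F] stand for e^(-2 w) and e^(2 w). *)
Definition pullb (T : 'M[A]_n) : 'M[B]_n := J *m map_mx th T *m J^T.
Hypothesis th_metric : pullb (gd g) = F *: gd k.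

Local Notation V := (gu k).
Implicit Types (f h u : A) (S T : 'M[A]_n).

(** The metric hypothesis makes [J^T *m V] a one-sided inverse of E J th(G), hence a two-sided one;
    the other side is the relation between the inverse metrics. *)
Lemma th_gu : J^T *m V *m J = F *: map_mx th (gu g).
Proof.
have e : (E *: (J *m map_mx th (gd g))) *m (J^T *m V) = 1%:M.
  rewrite mulmxA -scalemxAl -/(pullb _) th_metric scalerA EF scale1r.
  exact: gdu.
have := mulmx1C e; rewrite -scalemxAr => e'.
have {}e' : J^T *m V *m J *m map_mx th (gd g) = F *: 1%:M.
  by rewrite -e' scalerA mulrC EF scale1r mulmxA.
rewrite -[LHS]mulmx1 -(map_mx1 th) -(gdu g) map_mxM mulmxA e'.
by rewrite -scalemxAl mul1mx.
Qed.

Lemma th_grF f h : F * th (gr g f h) = gr k (th f) (th h).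
Proof.
rewrite /gr !th_grd trmx_mul !mulmxA -(mulmxA _ _ V) -(mulmxA _ _ J) th_gu.
rewrite -scalemxAr -scalemxAl [RHS]mxE; congr (F * _).
by rewrite map_trmx -!map_mxM [RHS]mxE.
Qed.

Lemma cancelE (x y : B) : F * x = y -> x = E * y.
Proof. by move=> <-; rewrite mulrA EF mul1r. Qed.

Lemma th_gr f h : th (gr g f h) = E * gr k (th f) (th h).
Proof. exact/cancelE/th_grF. Qed.

Lemma th_trF T : F * th (\tr (gu g *m T)) = \tr (V *m pullb T).
Proof.
rewrite /pullb !mulmxA [RHS]mxtrace_mulC !mulmxA th_gu -!scalemxAl mxtraceZ.
by rewrite -map_mxM trace_map_mx.
Qed.

Lemma th_tr T : th (\tr (gu g *m T)) = E * \tr (V *m pullb T).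
Proof. exact/cancelE/th_trF. Qed.

Lemma th_ipF S T : F ^+ 2 * th (ip g S T) = ip k (pullb S) (pullb T).
Proof.
rewrite /ip /pullb !mulmxA [RHS]mxtrace_mulC !mulmxA th_gu.
rewrite -(mulmxA _ J^T V) -(mulmxA _ _ J) th_gu -!scalemxAr -!scalemxAl.
by rewrite !mxtraceZ mulrA -expr2 -!map_mxM trace_map_mx.
Qed.

Lemma cancelE2 (x y : B) : F ^+ 2 * x = y -> x = E ^+ 2 * y.
Proof. by move=> <-; rewrite mulrA -exprMn EF expr1n mul1r. Qed.

Lemma th_ip S T : th (ip g S T) = E ^+ 2 * ip k (pullb S) (pullb T).
Proof. exact/cancelE2/th_ipF. Qed.

Lemma pullb_ot f h : pullb (ot f h) = ot (th f) (th h).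
Proof. by rewrite /pullb /ot map_mxM !th_grd trmx_mul map_trmx !mulmxA. Qed.

Lemma th_bil T f h : th (bil g T f h) = E ^+ 2 * bil k (pullb T) (th f) (th h).
Proof. by rewrite -!ip_ot th_ip pullb_ot. Qed.

(** On the images of the coordinate functions, [bil] reads off the entries of P S P^T with P = J^T
    V, and P is invertible. Hence a tensor on the target is determined by functions coming from the
    source. *)
Lemma bil_ext (S T : 'M[B]_n) :
  (forall f h, bil k S (th f) (th h) = bil k T (th f) (th h)) -> S = T.
Proof.
move=> ST; pose P := J^T *m V.
have e U i j : bil k U (th (crd A i)) (th (crd A j)) = (P *m U *m P^T) i j.
  rewrite /bil !th_grd !grd_crd !trmx_mul gu_sym trmxK !map_delta_mx.
  have d (M : 'M[B]_n) : ((delta_mx 0 i : 'rV_n) *m M *m (delta_mx j 0 : 'cV_n))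
    0 0 = M i j.
    by rewrite -rowE -colE !mxE.
  by rewrite -[RHS]d trmx_delta !mulmxA.
have PP : P *m (E *: (J *m map_mx th (gd g))) = 1%:M.
  apply: mulmx1C; rewrite mulmxA -scalemxAl -/(pullb _) th_metric.
  by rewrite scalerA EF scale1r gdu.
have /mulmx1C QP := PP; set Q := E *: _ in QP PP.
have {}ST : P *m S *m P^T = P *m T *m P^T.
  by apply/matrixP=> i j; rewrite -!e.
have c U : U = Q *m (P *m U *m P^T) *m Q^T.
  move: QP; clear; move: P Q => P' Q' QP'.
  by rewrite !mulmxA QP' mul1mx -mulmxA -trmx_mul QP' trmx1 mulmx1.
by rewrite (c S) ST -c.
Qed.

(** Tested on gradients, the Hessian is a combination of nested pairings. Each pairing acquires a
    factor [E], and differentiating the inner [E] by dE = -2 E dw produces the correction terms. *)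
Lemma pullb_hess f : pullb (hess g f) =
  hess k (th f) - ot w (th f) - ot (th f) w + gr k w (th f) *: gd k.
Proof.
apply: bil_ext => h u; apply: mul2I.
have grE x : gr k E x = - 2 * E * gr k w x by apply: gr_exp.
have -> : bil k (pullb (hess g f)) (th h) (th u) = F ^+ 2 * th (bil g (hess g f)
  h u).
  by rewrite th_bil mulrA -exprMn [F * E]mulrC EF expr1n mul1r.
have -> : (2 : B) = th 2 by rewrite rmorph_nat.
rewrite mulrCA -rmorphM hess_gr.
rewrite rmorphB rmorphD !th_gr !bilD !bilN bilZ bil_gd !bil_ot rmorph_nat.
rewrite !grMr !(grC _ _ E) !grE.
have -> (b x y z : B) : 2 * (b - x - y + z) = 2 * b - 2 * (x + y - z) by ring.
rewrite hess_gr.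
rewrite (grC k (th h) w) (grC k (th h) (th f)).
(* [ring] does not know E F = 1; the factor (E F)^2 makes both sides equal as polynomials. *)
rewrite -[RHS]mul1r -(expr1n _ 2) -EF; ring.
Qed.

Local Notation N2 := (n%:R - 2).

Lemma der_N2 i : der i (N2 : B) = 0.
Proof. by rewrite -!(rmorph_nat (ccst B)) -rmorphB der_cst. Qed.

Lemma gr_E x : gr k E x = - 2 * E * gr k w x.
Proof. exact: gr_exp. Qed.

Lemma der_N2' i : der i (- 2 : B) = 0.
Proof. by rewrite -(rmorph_nat (ccst B)) derN der_cst oppr0. Qed.

Lemma lap_E : lap k E = E * (4 * gr k w w - 2 * lap k w).
Proof. by rewrite (lap_exp k der_N2' derE); ring. Qed.

Lemma lap_EM x : lap k (E * x) =
  E * (lap k x - 4 * gr k w x + (4 * gr k w w - 2 * lap k w) * x).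
Proof. by rewrite lapM lap_E gr_E; ring. Qed.

Lemma gr_EM x y : gr k (E * x) y = E * (gr k x y - 2 * x * gr k w y).
Proof. by rewrite grMl gr_E; ring. Qed.

Lemma gr_EMr x y : gr k y (E * x) = E * (gr k y x - 2 * x * gr k y w).
Proof. by rewrite grC gr_EM (grC k w) (grC k x). Qed.

Lemma gr_N2l x y : gr k (N2 * x) y = N2 * gr k x y.
Proof. by rewrite grMl (gr_cst _ _ der_N2); ring. Qed.

Lemma gr_N2r x y : gr k y (N2 * x) = N2 * gr k y x.
Proof. by rewrite grC gr_N2l grC. Qed.

Lemma th_lap f :
  th (lap g f) = E * (lap k (th f) + N2 * gr k w (th f)).
Proof.
rewrite th_tr pullb_hess !(trgD, trgN, trgZ) !tr_ot tr_gd -lapE.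
by rewrite (grC k (th f)); ring.
Qed.

(** The Bochner formula expresses Ric through [lap], [gr] and [hess], whose transformation laws are
    known. Applying it again on the target turns lap <dx, dy> back into Ric, and the derivatives of
    [x] and [y] beyond the first cancel. *)
Lemma pullb_ric : pullb (ric g) = ric k - N2 *: (hess k w - ot w w)
  - (lap k w + N2 * gr k w w) *: gd k.
Proof.
apply: bil_ext => f h; apply: mul2I.
have -> : bil k (pullb (ric g)) (th f) (th h) = F ^+ 2 * th (bil g (ric g) f h).
  by rewrite th_bil mulrA -exprMn [F * E]mulrC EF expr1n mul1r.
have b2 (A0 : diffRing R n) (g0 : diffMetric A0) (x y : A0) : 2 * bil g0 (ric g0)
  x y =
    lap g0 (gr g0 x y) - gr g0 (lap g0 x) y - gr g0 x (lap g0 y)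
    - 2 * ip g0 (hess g0 x) (hess g0 y).
  by rewrite bochner (bilC _ _ _ (ric_sym g0)); ring.
have -> : 2 * (F ^+ 2 * th (bil g (ric g) f h)) = F ^+ 2 * th (2 * bil g (ric g)
  f h).
  by rewrite rmorphM rmorph_nat; ring.
rewrite b2 !rmorphB rmorphM rmorph_nat th_lap !th_gr !th_lap th_ip !pullb_hess.
move: (th f) (th h) => x y.
rewrite lap_EM !gr_EM !gr_EMr !(grDl, grDr, gr_N2l, gr_N2r) !(gr_gr, gr_grl).
rewrite !(ipDl, ipDr, ipNl, ipNr, ipZl, ipZr, ip_gdl, ip_gdr) !ip_ot !ip_otl.
rewrite -!lapE !tr_ot !bilD !bilN !bilZ !bilD !bilN !bil_gd !bil_ot tr_gd bochner.
rewrite (bilC _ y x (ric_sym k)).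
rewrite (grC k x w) (grC k y w) (grC k y x).
rewrite (bilC _ y x (hess_sym _ _)) !(bilC _ x w (hess_sym _ _)).
rewrite !(bilC _ y w (hess_sym _ _)).
have EF2 t : t = (E * F) ^+ 2 * t by rewrite EF expr1n mul1r.
rewrite [RHS]EF2; ring.
Qed.

Lemma pullbD S T : pullb (S + T) = pullb S + pullb T.
Proof. by rewrite /pullb map_mxD mulmxDr mulmxDl. Qed.

Lemma pullbN S : pullb (- S) = - pullb S.
Proof. by rewrite /pullb map_mxN mulmxN mulNmx. Qed.

Lemma pullbZ c S : pullb (c *: S) = th c *: pullb S.
Proof. by rewrite /pullb map_mxZ -scalemxAr -scalemxAl. Qed.

Hypothesis n_gt2 : (2 < n)%N.

Local Notation s := (ccst B 2^-1 * gr k w w).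

Lemma grww : gr k w w = 2 * s.
Proof. by rewrite mulrA [2 * _]mulrC cst_half mul1r. Qed.

Lemma th_scal : th (scal g) =
  E * (scal k - 2 * (n%:R - 1) * (lap k w + N2 * s)).
Proof.
rewrite /scal /ricmix th_tr pullb_ric.
rewrite !(trgD, trgN, trgZ) tr_ot tr_gd -/(lap k w) -/(ricmix k) -/(scal k).
by move: grww; move: s => s0 ->; ring.
Qed.

Lemma th_schouten_tr : th (schouten_tr g) = E * (schouten_tr k - lap k w - N2 * s).
Proof.
rewrite /schouten_tr rmorphM th_cst th_scal.
set c := ccst B (2 * _)^-1; have c1 : c * (2 * (n%:R - 1)) = 1.
  rewrite /c -(rmorph_nat (ccst B) n) -(rmorph_nat (ccst B) 2).
  have -> : ccst B n%:R - 1 = ccst B (n%:R - 1) by rewrite rmorphB rmorph1.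
  by rewrite -!rmorphM mulVf ?rmorph1// mulf_neq0 ?pnatr_eq0 ?nB1_neq0.
by rewrite mulrCA mulrBr [c * (2 * _ * _)]mulrA c1 mul1r; ring.
Qed.

Lemma pullb_schouten : pullb (schouten g) = schouten k - hess k w + ot w w - s *:
  gd k.
Proof.
rewrite /schouten pullbZ pullbD pullbN pullbZ th_metric th_cst pullb_ric
  th_schouten_tr.
set c := ccst B (n%:R - 2)^-1; have c1 : c * N2 = 1.
  rewrite /c -(rmorph_nat (ccst B) n) -(rmorph_nat (ccst B) 2) -rmorphB -rmorphM.
  by rewrite mulVf ?rmorph1// nB2_neq0.
rewrite scalerA (_ : E * _ * F = schouten_tr k - lap k w - N2 * s); last first.
  by rewrite mulrAC EF mul1r.
move: grww; move: s => s0 ->; apply/matrixP=> i j.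
rewrite /schouten -/c !(mxDE, mxNE, mxZE).
have c2 t : t = c * N2 * t by rewrite c1 mul1r.
rewrite [in RHS](c2 (hess k w i j)) [in RHS](c2 (ot w w i j)).
by rewrite [in RHS](c2 (s0 * _)); ring.
Qed.

Variable Bx : B.
Local Notation a := (conf_weight : B).
Hypothesis derBx : forall i, der i Bx = a * Bx * der i w.

Lemma der_conf_weight i : der i a = 0. Proof. exact: der_cst. Qed.

Lemma gr_B x : gr k Bx x = a * Bx * gr k w x.
Proof. exact: gr_exp. Qed.

Lemma lap_BM x : lap k (Bx * x) =
  Bx * (lap k x + 2 * a * gr k w x + (a * lap k w + a ^+ 2 * gr k w w) * x).
Proof. by rewrite lapM (lap_exp _ der_conf_weight derBx) gr_B; ring. Qed.

Lemma hess_BM x : hess k (Bx * x) =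
  Bx *: (hess k x + a *: ot w x + a *: ot x w
         + (a * x) *: hess k w + (a ^+ 2 * x) *: ot w w).
Proof.
have oB (u : B) : ot (Bx : B) u = (a * Bx) *: ot w u.
  rewrite /ot; have -> : grd Bx = (a * Bx) *: grd w.
    by apply/matrixP=> i j; rewrite !mxE derBx.
  by rewrite scalemxAl.
have oB' (u : B) : ot u (Bx : B) = (a * Bx) *: ot u w.
  rewrite /ot; have -> : grd Bx = (a * Bx) *: grd w.
    by apply/matrixP=> i j; rewrite !mxE derBx.
  by rewrite linearZ/= scalemxAr.
rewrite hessM (hess_exp _ der_conf_weight derBx) oB oB'.
by apply/matrixP=> i j; rewrite !(mxDE, mxZE); ring.
Qed.

Lemma half2 (x : B) : ccst B 2^-1 * (x + x) = x.
Proof.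
by rewrite (_ : x + x = 2 * x) ?mulrA ?cst_half ?mul1r//; ring.
Qed.

Lemma gr_s x : gr k s x = bil k (hess k w) w x.
Proof.
rewrite gr_cstM; last by move=> i; rewrite der_cst.
by rewrite gr_grl half2 (bilC _ x w (hess_sym _ _)).
Qed.

Lemma bil_ric x y :
  bil k (ric k) x y = N2 * bil k (schouten k) x y + schouten_tr k * gr k x y.
Proof. by rewrite {1}(ricE k n_gt2) bilD !bilZ bil_gd. Qed.

(** Half of the Bochner formula for [w] paired with itself, with Ric written through the Schouten
    tensor. *)
Lemma lap_s : lap k s = gr k (lap k w) w + ip k (hess k w) (hess k w)
  + N2 * bil k (schouten k) w w + schouten_tr k * (2 * s).
Proof.
rewrite lap_cstM; last by move=> i; rewrite der_cst.
rewrite bochner (grC k w (lap k w)) bil_ric -grww.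
set x := gr k _ w; set y := ip k _ _; set z := _ * bil _ _ _ _ + _.
by rewrite -[RHS]half2; congr (_ * _); rewrite /z; ring.
Qed.

Lemma bochner_schouten x y : lap k (gr k x y) =
  gr k (lap k x) y + gr k x (lap k y) + 2 * ip k (hess k x) (hess k y)
  + 2 * (N2 * bil k (schouten k) x y + schouten_tr k * gr k x y).
Proof. by rewrite bochner (bilC _ y x (ric_sym k)) bil_ric; ring. Qed.

Lemma th_ip_hess f (x := th f) : th (ip g (schouten g) (hess g f)) = E ^+ 2 *
  (ip k (schouten k) (hess k x) - ip k (hess k w) (hess k x)
   + bil k (hess k x) w w - s * lap k x
   - 2 * (bil k (schouten k) w x - bil k (hess k w) w x + 2 * s * gr k w x
          - s * gr k w x)
   + gr k w x * (schouten_tr k - lap k w + 2 * s - s * n%:R)).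
Proof.
rewrite th_ip pullb_schouten pullb_hess -/x; congr (_ * _).
(* Generalising s, P and J keeps only the relations <dw, dw> = 2 s, tr P = J and P^T = P, and leaves
   atoms for [ring]. *)
move: grww; move: s => t wt; move: (tr_schouten k n_gt2) (schouten_sym k).
move: (schouten k) (schouten_tr k) => P j tP sP.
rewrite !(ipDl, ipDr, ipNl, ipNr, ipZl, ipZr, ip_gdl, ip_gdr) !ip_ot !ip_otl.
rewrite !(trgN, trgZ, tr_ot, tr_gd) tP -!/(lap k _) !bil_ot ?(bilC _ x w sP).
by rewrite !(bilC _ x w (hess_sym _ _)) (grC k x w) wt; ring.
Qed.

Lemma th_ip_schouten : th (ip g (schouten g) (schouten g)) = E ^+ 2 *
  (ip k (schouten k) (schouten k) + ip k (hess k w) (hess k w) + 4 * s ^+ 2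
   + s ^+ 2 * n%:R
   + 2 * (- ip k (schouten k) (hess k w) + bil k (schouten k) w w - s *
     schouten_tr k
          - bil k (hess k w) w w + s * lap k w - 2 * s ^+ 2)).
Proof.
rewrite th_ip pullb_schouten; congr (_ * _).
move: grww; move: s => t wt; move: (tr_schouten k n_gt2) (schouten_sym k).
move: (schouten k) (schouten_tr k) => P j tP sP.
rewrite !(ipDl, ipDr, ipNl, ipNr, ipZl, ipZr, ip_gdl, ip_gdr) !ip_ot !ip_otl.
rewrite !(trgN, trgZ, tr_ot, tr_gd) tP -!/(lap k _) !bil_ot (ipC k (hess k w) P).
by rewrite wt; ring.
Qed.

Lemma th_gr_schouten_tr f (x := th f) : th (gr g (schouten_tr g) f) = E ^+ 2 *
  (gr k (schouten_tr k) x - gr k (lap k w) x - N2 * bil k (hess k w) w x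
   - 2 * (schouten_tr k - lap k w - N2 * s) * gr k w x).
Proof.
rewrite th_gr th_schouten_tr gr_EM !(grDl, grNl) gr_N2l gr_s -/x; ring.
Qed.

(** The outer Laplacian also differentiates the factor [E] left by the inner one: this accounts for
    the -4 beside n - 2 and for the terms of order zero. *)
Lemma th_lap_lap f (x := th f) (Y := lap k x + N2 * gr k w x) :
  th (lap g (lap g f)) = E ^+ 2 * (lap k Y + (N2 - 4) * gr k w Y
    + (8 * s - 2 * lap k w - 4 * N2 * s) * Y).
Proof.
rewrite !th_lap lap_EM gr_EMr -/x -/Y; move: grww; move: s => t ->; ring.
Qed.

Lemma th_lap_schouten_tr (Y := schouten_tr k - lap k w - N2 * s) :
  th (lap g (schouten_tr g)) = E ^+ 2 * (lap k Y + (N2 - 4) * gr k w Y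
    + (8 * s - 2 * lap k w - 4 * N2 * s) * Y).
Proof.
rewrite th_lap th_schouten_tr -/Y lap_EM gr_EMr.
by move: (Y) => Z; move: grww; move: s => t ->; ring.
Qed.

Lemma lap_lap_BM x (Y := lap k x + 2 * a * gr k w x
    + (a * (lap k w * x) + 2 * a ^+ 2 * (s * x))) :
  lap k (lap k (Bx * x)) = Bx * (lap k Y + 2 * a * gr k w Y
    + (a * lap k w + 2 * a ^+ 2 * s) * Y).
Proof.
rewrite lap_BM (_ : lap k x + _ + _ = Y) ?lap_BM.
  by move: (Y) => Z; move: grww; move: s => t ->; ring.
by rewrite /Y; move: grww; move: s => t ->; ring.
Qed.

(** Every ingredient on the left has weight [E ^+ 2], and every derivative of Bx x is [Bx] times an
    expression in [w] and x. Both sides thus share the factor E^2 Bx, and the cofactors agree by the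
    Bochner formula and n = 2 a + 4. *)
Lemma conformal_paneitz f :
  Bx * th (paneitz_schouten g f) = E ^+ 2 * paneitz_schouten k (Bx * th f).
Proof.
have th_conf_weight : th (conf_weight : A) = a by exact: th_cst.
have e (t i1 g1 j l1 lj p c y : A) :
    th (t + 4 * (i1 + g1) - (n%:R - 2) * (j * l1 + g1)
        + c * (- lj - 2 * p + (c + 2) * j ^+ 2) * y) =
    th t + 4 * (th i1 + th g1) - N2 * (th j * th l1 + th g1)
    + th c * (- th lj - 2 * th p + (th c + 2) * th j ^+ 2) * th y.
  by ring.
rewrite /paneitz_schouten e th_conf_weight.
rewrite th_lap_lap th_ip_hess th_gr_schouten_tr th_lap_schouten_tr th_ip_schouten
  th_lap th_schouten_tr.
move: (th f) => x; rewrite lap_lap_BM lap_BM hess_BM.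
have da2 i : der i (2 * a) = 0.
  by rewrite derM der_conf_weight -(rmorph_nat (ccst B)) der_cst; ring.
have daa i : der i (2 * a ^+ 2) = 0.
  by rewrite expr2 mulrA derM da2 der_conf_weight; ring.
(* The Laplacians of s and of <dw, dx> are rewritten by the Bochner formula; this produces the
   Schouten terms that match those from the contractions with P. *)
move: lap_s grww gr_s (bochner_schouten w x) (schouten_sym k); move: s => t.
move: (schouten k) (schouten_tr k) => P j lt wt gt bo sP.
rewrite grMr (grC k j Bx) gr_B !(ipDr, ipZr) !ip_ot.
rewrite !(lapD, lapN) !(lap_cstM _ _ der_N2) !(lap_cstM _ _ da2) !(lap_cstM _ _
  daa).
rewrite !(lap_cstM _ _ der_conf_weight) !(grDr, grNr) !gr_N2r !(grC k w (_ * _)).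
rewrite !(gr_cstM _ _ _ da2) !(gr_cstM _ _ _ daa) !(gr_cstM _ _ _ der_conf_weight).
rewrite !lapM lt bo !grMl !(grC k _ w) !(grC k w t) !gt !gr_gr wt.
rewrite (bilC _ x w sP) ?(bilC _ x w (hess_sym _ _)).
(* For [ring] the dimension and the weight are unrelated until n is replaced by 2 a + 4. *)
rewrite (conf_weightE : n%:R = _ :> B).
ring.
Qed.

End ConformalMap.

(** * The differential ring of smooth functions on an open set *)

Record oset (R : realType) (n : nat) := OSet {
  oset_set :> set 'rV[R]_n ;
  oset_open : open oset_set
}.

(* Normalised to vanish outside [U], so that equality on [U] is equality. *)
Record sfun (R : realType) (n : nat) (U : oset R n) := SFun {
  sval :> 'rV[R]_n -> R ;
  sfun_smooth : smooth_on U sval ;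
  sfun_off : forall y, ~ oset_set U y -> sval y = 0
}.

Section SmoothRing.
Context {R : realType} {n : nat} {UU : oset R n}.
Local Notation A := (sfun UU).
Local Notation U := (oset_set UU).
Implicit Types (f h : A) (u v : 'rV[R]_n -> R).
Let oU : open U := @oset_open R n UU.

Lemma sfunP f h : (forall y, U y -> f y = h y) -> f = h.
Proof.
case: f h => [f sf f0] [h sh h0] /= e.
have {}e : f = h.
  by apply/funext => y; have [/e//|Uy] := pselect (U y); rewrite f0 ?h0.
by rewrite e in sf f0 *; congr SFun; exact: Prop_irrelevance.
Qed.

Definition restr u : 'rV[R]_n -> R := fun y => if `[< U y >] then u y else 0.

Lemma restrE u y : U y -> restr u y = u y.
Proof. by move=> Uy; rewrite /restr asboolT. Qed.

Lemma restr_off u y : ~ U y -> restr u y = 0.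
Proof. by move=> Uy; rewrite /restr asboolF. Qed.

Lemma restr_smooth u : smooth_on U u -> smooth_on U (restr u).
Proof. by apply: eq_smooth_on => // y Uy; rewrite restrE. Qed.

Definition sfun_of u (su : smooth_on U u) : A :=
  SFun (restr_smooth su) (@restr_off u).

Lemma sfun_ofE u (su : smooth_on U u) y : U y -> sfun_of su y = u y.
Proof. exact: restrE. Qed.

Definition szero : A := sfun_of (@smooth_cst R n U 0 oU).
Definition sone : A := sfun_of (@smooth_cst R n U 1 oU).
Definition sadd f h : A := sfun_of (smoothD oU (sfun_smooth f) (sfun_smooth h)).
Definition sopp f : A := sfun_of (smoothN oU (sfun_smooth f)).
Definition smul f h : A := sfun_of (smoothM oU (sfun_smooth f) (sfun_smooth h)).

HB.instance Definition _ := gen_eqMixin A.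
HB.instance Definition _ := gen_choiceMixin A.

Lemma saddA : associative sadd.
Proof. by move=> f h k; apply: sfunP => y Uy; rewrite !sfun_ofE// addrA. Qed.
Lemma saddC : commutative sadd.
Proof. by move=> f h; apply: sfunP => y Uy; rewrite !sfun_ofE// addrC. Qed.
Lemma sadd0 : left_id szero sadd.
Proof. by move=> f; apply: sfunP => y Uy; rewrite !sfun_ofE// add0r. Qed.
Lemma saddN : left_inverse szero sopp sadd.
Proof. by move=> f; apply: sfunP => y Uy; rewrite !sfun_ofE// addNr. Qed.
HB.instance Definition _ := GRing.isZmodule.Build A saddA saddC sadd0 saddN.

Lemma smulA : associative smul.
Proof. by move=> f h k; apply: sfunP => y Uy; rewrite !sfun_ofE// mulrA. Qed.
Lemma smulC : commutative smul.
Proof. by move=> f h; apply: sfunP => y Uy; rewrite !sfun_ofE// mulrC. Qed.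
Lemma smul1 : left_id sone smul.
Proof. by move=> f; apply: sfunP => y Uy; rewrite !sfun_ofE// mul1r. Qed.
Lemma smulD : left_distributive smul sadd.
Proof. by move=> f h k; apply: sfunP => y Uy; rewrite !sfun_ofE// mulrDl. Qed.
HB.instance Definition _ := GRing.Zmodule_isComPzRing.Build A smulA smulC smul1
  smulD.

Lemma sfunDE f h y : U y -> (f + h : A) y = f y + h y.
Proof. exact: sfun_ofE. Qed.
Lemma sfunME f h y : U y -> (f * h : A) y = f y * h y.
Proof. exact: sfun_ofE. Qed.
Lemma sfunNE f y : U y -> (- f : A) y = - f y.
Proof. exact: sfun_ofE. Qed.
Lemma sfun0E y : U y -> (0 : A) y = 0.
Proof. exact: sfun_ofE. Qed.
Lemma sfun1E y : U y -> (1 : A) y = 1.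
Proof. exact: sfun_ofE. Qed.

Lemma sfun_sumE (I : Type) (r : seq I) (F : I -> A) y : U y ->
  (\sum_(x <- r) F x) y = \sum_(x <- r) F x y.
Proof.
move=> Uy; elim: r => [|a r IH]; first by rewrite !big_nil sfun0E.
by rewrite !big_cons sfunDE// IH.
Qed.

(* Opaque, so that unification never unfolds derivatives. *)
Lemma sder_subproof i f : {h : A | forall y, U y -> h y = partial i f y}.
Proof.
by exists (sfun_of (smooth_on_partial i (sfun_smooth f))) => y Uy; exact: sfun_ofE.
Qed.

Definition sder i f : A := proj1_sig (sder_subproof i f).

Lemma sderE i f y : U y -> sder i f y = partial i f y.
Proof. by move=> Uy; rewrite /sder; case: sder_subproof => h /= ->. Qed.

Definition scst c : A := sfun_of (smooth_cst c oU).

Lemma scst_zmod : zmod_morphism scst.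
Proof.
by move=> a b; apply: sfunP => y Uy; rewrite sfunDE// sfunNE// !sfun_ofE.
Qed.
Lemma scst_monoid : monoid_morphism scst.
Proof.
by split=> [|a b]; apply: sfunP => y Uy; rewrite ?sfunME// ?sfun1E// !sfun_ofE.
Qed.
HB.instance Definition _ := GRing.isZmodMorphism.Build R A scst scst_zmod.
HB.instance Definition _ := GRing.isMonoidMorphism.Build R A scst scst_monoid.

Definition scrd i : A := sfun_of (smooth_coord i oU).

Lemma sfun_derivable f y i : U y -> derivable f y 'e_i.
Proof. exact: smooth_on_derivable (sfun_smooth f). Qed.

Lemma partial_eq u v y i : U y -> (forall z, U z -> u z = v z) ->
  partial i u y = partial i v y.
Proof. by move=> Uy uv; apply: partial_near; exact: open_near oU Uy uv. Qed.

Lemma sderD i : {morph sder i : f h / f + h}.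
Proof.
move=> f h; apply: sfunP => y Uy; rewrite sfunDE// !sderE//.
rewrite (partial_eq (v := fun z => f z + h z) _ Uy (sfunDE f h)).
by apply: partialD; exact: sfun_derivable.
Qed.

Lemma sderM i f h : sder i (f * h) = sder i f * h + f * sder i h.
Proof.
apply: sfunP => y Uy; rewrite sfunDE// !sfunME// !sderE//.
rewrite (partial_eq (v := fun z => f z * h z) _ Uy (sfunME f h)).
by apply: partialM; exact: sfun_derivable.
Qed.

Lemma sderC i j f : sder i (sder j f) = sder j (sder i f).
Proof.
have sder2 k l y : U y -> sder k (sder l f) y = partial k (partial l f) y.
  move=> Uy; rewrite sderE//.
  exact: (partial_eq k Uy (fun z Uz => sderE l f Uz)).
apply: sfunP => y Uy.
exact: etrans (sder2 i j y Uy) (etrans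
  (clairaut i j oU (sfun_smooth f) Uy) (esym (sder2 j i y Uy))).
Qed.

Lemma sder_cst i c : sder i (scst c) = 0.
Proof.
apply: sfunP => y Uy; rewrite sderE// sfun0E//.
by rewrite (partial_eq (v := fun=> c) _ Uy) ?partial_cst// => z Uz;
  rewrite sfun_ofE.
Qed.

Lemma sder_crd i j : sder i (scrd j) = (i == j)%:R.
Proof.
have -> : (i == j)%:R = scst (i == j)%:R by rewrite rmorph_nat.
apply: sfunP => y Uy; rewrite sderE// sfun_ofE//.
rewrite (partial_eq (v := fun z => z 0 j) _ Uy) ?partial_coord//.
by move=> z Uz; rewrite sfun_ofE.
Qed.

Definition sfun_ring : diffRing R n :=
  DiffRing sderD sderM sderC sder_cst sder_crd.

End SmoothRing.

(** * Dictionary between functions on the open set and ring elements *)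

Section Represents.
Context {R : realType} {n : nat} {UU : oset R n}.
Local Notation A := (sfun_ring (UU := UU)).
Local Notation U := (oset_set UU).
Implicit Types (f h : A) (u v : 'rV[R]_n -> R).

(** The functions of the statement are total and arbitrary outside the domain; they are related to
    ring elements by agreement on [U], which partial differentiation respects because [U] is
    open. *)
Definition rep u f := forall z, U z -> u z = sval f z.

Lemma rep_sfun_of u (su : smooth_on U u) : rep u (sfun_of su).
Proof. by move=> z Uz; rewrite sfun_ofE. Qed.

Lemma repD u v f h : rep u f -> rep v h -> rep (fun z => u z + v z) (f + h).
Proof. by move=> uf vh z Uz; rewrite sfunDE// uf// vh. Qed.

Lemma repN u f : rep u f -> rep (fun z => - u z) (- f).
Proof. by move=> uf z Uz; rewrite sfunNE// uf. Qed.

Lemma repB u v f h : rep u f -> rep v h -> rep (fun z => u z - v z) (f - h).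
Proof. by move=> uf vh; apply: repD => //; exact: repN. Qed.

Lemma repM u v f h : rep u f -> rep v h -> rep (fun z => u z * v z) (f * h).
Proof. by move=> uf vh z Uz; rewrite sfunME// uf// vh. Qed.

Lemma repX u f k : rep u f -> rep (fun z => u z ^+ k) (f ^+ k).
Proof.
move=> uf; elim: k => [|k IH] z Uz; first by rewrite expr0 sfun1E.
by rewrite !exprS sfunME// -IH// uf.
Qed.

Lemma repC c : rep (fun=> c) (ccst A c).
Proof. by move=> z Uz; rewrite sfun_ofE. Qed.

Lemma rep_sum (I : Type) (r : seq I) (u : I -> 'rV[R]_n -> R) (F : I -> A) :
  (forall x, rep (u x) (F x)) ->
  rep (fun z => \sum_(x <- r) u x z) (\sum_(x <- r) F x).
Proof.
by move=> uF z Uz; rewrite sfun_sumE//; apply: eq_bigr => x _; exact: uF.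
Qed.

Lemma rep_partial i u f : rep u f -> rep (partial i u) (der i f).
Proof.
by move=> uf z Uz; exact: etrans (partial_eq i Uz uf) (esym (sderE i f Uz)).
Qed.

Lemma rep_eq u f h : f = h -> rep u f -> rep u h.
Proof. by move=> ->. Qed.

End Represents.

Section Bridge.
Context {R : realType} {n : nat} {UU : oset R n}.
Local Notation A := (sfun_ring (UU := UU)).
Local Notation U := (oset_set UU).
Variable G : 'rV[R]_n -> 'M[R]_n.
Variable g : diffMetric A.
Hypothesis Gg : forall i j, rep (fun z => G z i j) (gd g i j).

(** Evaluating the ring identity G V = 1 at a point gives an inverse matrix there, and inverses are
    unique. *)
Lemma rep_ginv i j : rep (ginv G i j) (gu g i j).
Proof.
move=> z Uz; rewrite /ginv.
have e : G z *m (\matrix_(a, b) sval (gu g a b) z) = 1%:M.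
  apply/matrixP=> a b; rewrite mxE.
  have := congr1 (fun B : 'M[A]_n => sval (B a b) z) (gdu g).
  rewrite [LHS]/= mxE sfun_sumE// => E.
  transitivity (\sum_k sval (gd g a k * gu g k b) z).
    by apply: eq_bigr => k _; rewrite [RHS]sfunME// mxE Gg.
  rewrite E !mxE; case: (a == b); [exact: sfun1E|exact: sfun0E].
have [Gu _] := mulmx1_unit e.
by rewrite -[invmx _]mulmx1 -e mulmxA mulVmx// mul1mx mxE.
Qed.

Lemma rep_chr k i j : rep (christoffel G k i j) (chr g k i j).
Proof.
apply: repM; first exact: repC.
apply: rep_sum => l; apply: repM; first exact: rep_ginv.
by apply: repB; [apply: repD|]; apply: rep_partial; exact: Gg.
Qed.

Lemma rep_laplace u f : rep u f -> rep (laplace G u) (lap g f).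
Proof.
move=> uf; apply: (rep_eq (f := \sum_i \sum_j gu g i j *
    (der i (der j f) - \sum_k chr g k i j * der k f))).
  exact/esym/lap_sum.
apply: rep_sum => i; apply: rep_sum => j; apply: repM; first exact: rep_ginv.
apply: repB; first by do 2 apply: rep_partial.
by apply: rep_sum => k; apply: repM; [exact: rep_chr|exact: rep_partial].
Qed.

Lemma rep_ricci i j : rep (ricci G i j) (- ric g i j).
Proof.
apply: repN; apply: (rep_eq (f :=
  \sum_k (der k (chr g k i j) - der j (chr g k i k))
  + \sum_k \sum_l (chr g k k l * chr g l i j - chr g k j l * chr g l i k))).
    exact/esym/ric_chr.
apply: repD.
  by apply: rep_sum => k; apply: repB; apply: rep_partial; exact: rep_chr.
by apply: rep_sum => k; apply: rep_sum => l; apply: repB; apply: repM;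
  exact: rep_chr.
Qed.

Lemma rep_ricci_up i j : rep (ricci_up G i j) (- (ricmix g *m gu g) j i).
Proof.
apply: (rep_eq (ric_up_sum g i j)); apply: rep_sum => k; apply: rep_sum => l.
by apply: repM; [apply: repM; exact: rep_ginv|exact: rep_ricci].
Qed.

Lemma rep_scal : rep (scalar_curv G) (- scal g).
Proof.
apply: (rep_eq (scal_sum g)); apply: rep_sum => i; apply: rep_sum => j.
by apply: repM; [exact: rep_ginv|exact: rep_ricci].
Qed.

Lemma rep_ricci_sq : rep (ricci_sq G) (ip g (ric g) (ric g)).
Proof.
apply: (rep_eq (ip_ric_sum g)); apply: rep_sum => i; apply: rep_sum => j.
by apply: repM; [exact: rep_ricci_up|exact: rep_ricci].
Qed.

Lemma rep_divergence (W : 'I_n -> 'rV[R]_n -> R) (X : 'cV[A]_n) :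
  (forall j, rep (W j) (X j 0)) -> rep (divergence G W) (div g X).
Proof.
move=> WX; apply: (rep_eq (esym (div_sum g X))); apply: rep_sum => j.
apply: repD; first exact: rep_partial.
by apply: rep_sum => k; apply: repM; [exact: rep_chr|exact: WX].
Qed.

Lemma rep_Qop u f : rep u f -> rep (Qop G u) (paneitz_ric g f).
Proof.
move=> uf; apply: repD; first apply: repD.
- by do 2 apply: rep_laplace.
- apply: rep_divergence => j.
  set a := 4 / (n%:R - 2); set b := _ / _.
  apply: (rep_eq (paneitz_vec g (ccst A a) (ccst A b) f j)).
  apply: rep_sum => i; apply: repM; last exact: rep_partial.
  apply: repD; apply: repM.
  + by apply: repN; exact: repC.
  + exact: rep_ricci_up.
  + exact: repC.
  + by apply: repM; [exact: rep_ginv|exact: rep_scal].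
- apply: repM; last exact: uf.
  set a := (n%:R - 4) / (4 * _); set b := (n%:R - 4) / _.
  set c := _ / (16 * _ * _).
  apply: (rep_eq (f := ccst A a * lap g (- scal g)
    - ccst A b * ip g (ric g) (ric g) + ccst A c * (- scal g) ^+ 2)).
    by rewrite lapN sqrrN mulrN mulNr.
  apply: repD; first apply: repB.
  + by apply: repM; [exact: repC|apply: rep_laplace; exact: rep_scal].
  + by apply: repM; [exact: repC|exact: rep_ricci_sq].
  + by apply: repM; [exact: repC|apply: repX; exact: rep_scal].
Qed.

(** For n = 4 the order zero coefficients contain the factor n - 4, and those of the divergence
    become -2 and 8 / 12 = (-2) (-1 / 3). Pulling -2 out of the divergence uses the derivability of
    the components, hence the passage through the ring. *)
Lemma Qop_dim4 u (f : A) : rep u f -> n = 4%N ->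
  forall y, U y -> Qop G u y = Qop4 G u y.
Proof.
move=> uf n4 y Uy; have N4 : n%:R = 4 :> R by rewrite n4.
rewrite /Qop /Qop4 N4; set t := (X in _ + X * u y).
have -> : t = 0 by rewrite /t subrr !mul0r subrr add0r.
rewrite mul0r addr0; congr (_ + _).
pose W j z := \sum_i (ricci_up G i j z - 3^-1 * (ginv G i j z * scalar_curv G z))
  * partial i u z.
pose Y : 'cV[A]_n := \col_j \sum_i (- (ricmix g *m gu g) j i
  - ccst A 3^-1 * (gu g i j * - scal g)) * der i f.
have WY j : rep (W j) (Y j 0).
  rewrite mxE; apply: rep_sum => i; apply: repM; last exact: rep_partial.
  apply: repB; first exact: rep_ricci_up.
  by apply: repM; [exact: repC|apply: repM; [exact: rep_ginv|exact: rep_scal]].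
have W2 j : rep (fun z => -2 * W j z) ((ccst A (-2) *: Y) j 0).
  by rewrite mxE; apply: repM; [exact: repC|exact: WY].
have -> : (fun j z => \sum_i (- (4 / (4 - 2)) * ricci_up G i j z
    + (4 ^+ 2 - 4 * 4 + 8) / (2 * (4 - 1) * (4 - 2))
      * (ginv G i j z * scalar_curv G z)) * partial i u z)
    = (fun j z => -2 * W j z).
  apply/funext => j; apply/funext => z; rewrite mulr_sumr.
  by apply: eq_bigr => i _; field.
rewrite (rep_divergence W2)// divZ sfunDE// sfunME// sfun_ofE//.
rewrite -(rep_divergence WY)//.
have -> : grd (ccst A (-2)) = 0 by apply/matrixP=> i j; rewrite !mxE der_cst.
by rewrite trmx0 mul0mx mxE sfun0E// addr0 mulNr.
Qed.

End Bridge.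

(** * Metrics on an open set as metrics over its ring *)

Section Evaluation.
Context {R : realType} {n : nat} {UU : oset R n}.
Local Notation A := (sfun_ring (UU := UU)).
Local Notation U := (oset_set UU).

Section At.
Variables (y : 'rV[R]_n) (Uy : U y).

Definition sev (f : A) : R := sval f y.

Lemma sev_zmod : zmod_morphism sev.
Proof. by move=> f h; rewrite /sev sfunDE// sfunNE. Qed.
Lemma sev_monoid : monoid_morphism sev.
Proof. by split=> [|f h]; rewrite /sev ?sfun1E// sfunME. Qed.

Definition sevM : {rmorphism A -> R} :=
  HB.pack sev (GRing.isZmodMorphism.Build A R sev sev_zmod)
    (GRing.isMonoidMorphism.Build A R sev sev_monoid).

End At.

Variable G : 'rV[R]_n -> 'M[R]_n.
Hypothesis G_smooth : forall i j, smooth_on U (fun z => G z i j).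
Hypothesis G_sym : forall z, U z -> (G z)^T = G z.
Hypothesis G_unit : forall z, U z -> G z \in unitmx.

(** The inverse matrix is the adjugate times the inverse determinant, which is smooth because the
    determinant vanishes nowhere on [U]. *)
Lemma diffMetric_of :
  {g : diffMetric A | forall i j, rep (fun z => G z i j) (gd g i j)}.
Proof.
pose gA : 'M[A]_n := \matrix_(i, j) sfun_of (G_smooth i j).
have gAE i j z : U z -> sval (gA i j) z = G z i j.
  by move=> Uz; rewrite mxE sfun_ofE.
have gAT : gA^T = gA.
  apply/matrixP=> i j; rewrite mxE; apply: sfunP => z Uz.
  by rewrite !gAE// -[in LHS]G_sym// mxE.
(* Evaluation at a point is a ring morphism, so it commutes with the determinant. *)
have det0 z : U z -> sval (\det gA : A) z != 0.
  move=> Uz; have e : map_mx (sevM Uz) gA = G z.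
    by apply/matrixP=> i j; rewrite mxE; exact: gAE.
  have -> : sval (\det gA : A) z = \det (G z).
    by rewrite -e; exact: esym (det_map_mx (sevM Uz) gA).
  by have := G_unit Uz; rewrite unitmxE unitfE.
pose d : A := sfun_of (smoothV (@oset_open R n UU) det0 (sfun_smooth (\det gA :
  A))).
have dK : \det gA * d = 1.
  by apply: sfunP => z Uz; rewrite sfunME// sfun1E// sfun_ofE// mulfV ?det0.
have gK : gA *m (d *: \adj gA) = 1%:M.
  by rewrite -scalemxAr mul_mx_adj scale_scalar_mx mulrC dK.
by exists (DiffMetric gAT gK) => i j z Uz /=; rewrite gAE.
Qed.

End Evaluation.

(** * Composition with a smooth map as a morphism of differential rings *)

Section LocalConformal.
Context {R : realType} {n : nat} {UU VV : oset R n}.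
Local Notation A := (sfun_ring (UU := UU)).
Local Notation B := (sfun_ring (UU := VV)).
Local Notation U := (oset_set UU).
Local Notation V := (oset_set VV).
Variables (F : 'rV[R]_n -> 'rV[R]_n).
Hypothesis FVU : forall z, V z -> U (F z).
Hypothesis F_smooth : forall l, smooth_on V (fun z => F z 0 l).

Let oU : open U := @oset_open R n UU.
Let oV : open V := @oset_open R n VV.

Definition pull (f : A) : B := sfun_of (smooth_comp oU oV FVU F_smooth
  (sfun_smooth f)).

Lemma pullE f z : V z -> pull f z = f (F z).
Proof. exact: sfun_ofE. Qed.

Lemma pull_zmod : zmod_morphism pull.
Proof.
move=> f h; apply: sfunP => z Vz.
by rewrite sfunDE// sfunNE// !pullE// sfunDE ?sfunNE//; exact: FVU.
Qed.
Lemma pull_monoid : monoid_morphism pull.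
Proof.
by split=> [|f h]; apply: sfunP => z Vz;
  rewrite ?sfunME// ?sfun1E// !pullE// ?sfunME ?sfun1E//; exact: FVU.
Qed.
Definition pullM : {rmorphism A -> B} :=
  HB.pack pull (GRing.isZmodMorphism.Build A B pull pull_zmod)
    (GRing.isMonoidMorphism.Build A B pull pull_monoid).

Definition jac : 'M[B]_n :=
  \matrix_(i, k) sfun_of (smooth_on_partial i (F_smooth k)).

Lemma jacE i k z : V z -> sval (jac i k) z = partial i (fun y => F y 0 k) z.
Proof. by move=> Vz; rewrite mxE sfun_ofE. Qed.

Lemma grd_pull f : grd (pullM f : B) = jac *m map_mx pullM (grd f).
Proof.
apply/matrixP=> i a; rewrite [LHS]mxE mxE; apply: sfunP => z Vz.
rewrite sfun_sumE// [LHS](sderE i _ Vz).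
rewrite (partial_eq (v := f \o F) i Vz (fun y Vy => pullE f Vy)).
have [|_ ->] := @partial_comp _ _ f F z i _
    (smooth_on_differentiable oU (sfun_smooth f) (FVU Vz)).
  by move=> l; exact: smooth_on_derivable (F_smooth l) Vz.
apply: eq_bigr => k _; rewrite sfunME// jacE//; congr (_ * _).
by rewrite mxE [RHS]pullE// mxE [RHS]sderE//; exact: FVU.
Qed.

Lemma pull_cst c : pullM (ccst A c) = ccst B c.
Proof.
by apply: sfunP => z Vz; rewrite [LHS]pullE// !sfun_ofE//; exact: FVU.
Qed.

Lemma smoothZ (c : R) w : smooth_on V w -> smooth_on V (fun z => c * w z).
Proof. by move=> sw; apply: smoothM => //; exact: smooth_cst. Qed.

Definition sexp (c : R) (w : B) : B :=
  sfun_of (smooth_expR oV (smoothZ c (sfun_smooth w))).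

Lemma sexpE c w z : V z -> sexp c w z = expR (c * w z).
Proof. exact: sfun_ofE. Qed.

Lemma der_sexp c w i : der i (sexp c w : B) = ccst B c * sexp c w * der i w.
Proof.
apply: sfunP => z Vz; rewrite !sfunME// [LHS]sderE// [sder i w z]sderE//.
rewrite (partial_eq (v := @expR R \o (fun y => c * w y)) i Vz (sexpE c w)).
have dw : derivable (fun y => c * w y) z 'e_i.
  by apply: smooth_on_derivable Vz; apply: smoothZ; exact: sfun_smooth.
have d := is_derive_comp1 (is_derive_expR (c * w z)) dw.
rewrite /partial derive_val sexpE// sfun_ofE//.
have dsw : derivable (sval w) z 'e_i.
  exact: smooth_on_derivable (sfun_smooth w) Vz.
have := partialM (derivable_cst c z 'e_i) dsw.
rewrite /partial derive_cst mul0r add0r => ->; rewrite /cst; ring.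
Qed.

End LocalConformal.

(* The matrix below is the pullback of [G] along [F]. *)
Lemma local_conformal (R : realType) (n : nat) (UU VV : oset R n)
    (U := oset_set UU) (V := oset_set VV)
    (G H : 'rV[R]_n -> 'M[R]_n) (F : 'rV[R]_n -> 'rV[R]_n)
    (w u : 'rV[R]_n -> R) :
  (2 < n)%N ->
  (forall i j, smooth_on U (fun z => G z i j)) ->
  (forall z, U z -> (G z)^T = G z) -> (forall z, U z -> G z \in unitmx) ->
  (forall i j, smooth_on V (fun z => H z i j)) ->
  (forall z, V z -> (H z)^T = H z) -> (forall z, V z -> H z \in unitmx) ->
  (forall z, V z -> U (F z)) -> (forall l, smooth_on V (fun z => F z 0 l)) ->
  smooth_on V w -> smooth_on U u ->
  (forall z, V z -> \matrix_(i, j) (\sum_k \sum_l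
      partial i (fun y => F y 0 k) z * partial j (fun y => F y 0 l) z
      * G (F z) k l) = expR (2 * w z) *: H z) ->
  forall y, V y ->
  expR ((n%:R + 4) / 2 * w y) * Qop G u (F y) =
  Qop H (fun z => expR ((n%:R - 4) / 2 * w z) * u (F z)) y.
Proof.
move=> n2 sG yG uG sH yH uH FVU sF sw su FGH y Vy.
pose A := sfun_ring (UU := UU); pose B := sfun_ring (UU := VV).
have [g gE] := diffMetric_of sG yG uG.
have [k kE] := diffMetric_of sH yH uH.
pose th : {rmorphism A -> B} := pullM FVU sF.
pose J : 'M[B]_n := jac sF.
pose W : B := sfun_of sw.
pose E : B := sexp (- 2) W.
pose E' : B := sexp 2 W.
pose Bx : B := sexp ((n%:R - 4) / 2) W.
pose f : A := sfun_of su.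
have WE z : V z -> sval W z = w z by move=> Vz; rewrite sfun_ofE.
have EE' : E * E' = 1.
  apply: sfunP => z Vz; rewrite sfunME// sfun1E// !sexpE// -expRD.
  by rewrite mulNr addNr expR0.
have dE i : der i E = - 2 * E * der i W.
  by rewrite der_sexp rmorphN rmorph_nat.
have dB i : der i Bx = (conf_weight : B) * Bx * der i W by rewrite der_sexp.
have thm : pullb th J (gd g) = E' *: gd k.
  apply/matrixP=> i j; rewrite mxE [RHS]mxE; apply: sfunP => z Vz.
  rewrite [RHS]sfunME// -kE// sexpE// WE//.
  have := congr1 (fun M : 'M[R]_n => M i j) (FGH z Vz).
  rewrite /= !mxE => <-.
  rewrite sfun_sumE// exchange_big; apply: eq_bigr => l _.
  rewrite sfunME// [(_ *m _) _ _]mxE sfun_sumE// mulr_suml; apply: eq_bigr => a _.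
  rewrite [(_^T) _ _]mxE sfunME// !jacE// [map_mx _ _ _ _]mxE pullE//.
  by rewrite -(gE _ _ _ (FVU _ Vz)); ring.
have key := conformal_paneitz (fun c => pull_cst FVU sF c)
  (fun f => grd_pull FVU sF f) EE' dE thm n2 dB f.
rewrite -!paneitz_ric_schouten// in key.
have := congr1 (fun h : B => sval h y) key.
rewrite [X in X = _ -> _]sfunME// [X in _ = X -> _]sfunME//.
rewrite [sval (th _) y]pullE// -(rep_Qop gE (rep_sfun_of su));
  last exact: (FVU _ Vy).
have rB : rep (fun z => expR ((n%:R - 4) / 2 * w z) * u (F z)) (Bx * th f).
  apply: repM => z Vz; first by rewrite sexpE// WE.
  by rewrite pullE// sfun_ofE//; exact: (FVU _ Vz).
rewrite -(rep_Qop kE rB)//.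
rewrite expr2 sfunME// !sexpE// !WE// => e.
(* The two summands 2 w cancel the factor E^2 = e^(-4 w). *)
have -> : (n%:R + 4) / 2 * w y = 2 * w y + 2 * w y + (n%:R - 4) / 2 * w y.
  by field.
rewrite !expRD -mulrA e !mulrA -!expRD.
have -> : 2 * w y + 2 * w y + -2 * w y + -2 * w y = 0 by ring.
by rewrite expR0 mul1r.
Qed.

(** * Charts *)

Section Charts.
Context {R : realType} {n : nat} {M : smoothManifold R n}.
Implicit Types (c d : chart R n M) (f : M -> M) (g : metric M) (phi : M -> R).

Local Notation img c := (c @` cdom c).

Lemma imgP c z : img c z -> cdom c (cinv c z) /\ c (cinv c z) = z.
Proof. by case=> x cx <-; rewrite cmapK. Qed.

Lemma local_domP c d f z :
  local_dom c d f z <-> img c z /\ cdom d (f (cinv c z)).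
Proof.
split=> [[x [cx dx] <-]|[/imgP[cz zE] dz]]; first by rewrite cmapK//; split=> //;
  exists x.
by exists (cinv c z).
Qed.

Lemma local_dom_open c d f : continuous f -> open (local_dom c d f).
Proof.
move=> cf; rewrite openE => z /local_domP[cz dz].
have n1 : \forall y \near z, img c y by apply: open_nbhs_nbhs; split=> //;
  exact: cimg_open.
have n2 : \forall y \near z, cdom d (f (cinv c y)).
  have cfz : {for z, continuous (f \o cinv c)}.
    by apply: continuous_comp; [exact: cinv_continuous|exact: cf].
  by apply: cfz; apply: open_nbhs_nbhs; split=> //; exact: cdom_open.
by apply: filterS (filterI n1 n2) => y [? ?]; apply/local_domP.
Qed.

Lemma smooth_local_expr c d f phi : atlas M c -> atlas M d -> smooth_map f ->
  smooth_fun phi -> smooth_on (local_dom c d f) (phi \o f \o cinv c).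
Proof.
move=> ac ad [cf sf] sphi.
have oV : open (local_dom c d f) by exact: local_dom_open.
have oU : open (img d) by exact: cimg_open.
have VU z : local_dom c d f z -> img d (d (f (cinv c z))).
  by move=> /local_domP[_ dz]; exists (f (cinv c z)).
have e z : local_dom c d f z ->
    ((phi \o cinv d) \o (fun y => d (f (cinv c y)))) z = (phi \o f \o cinv c) z.
  by move=> /local_domP[_ dz] /=; rewrite cmapK.
apply: (eq_smooth_on oV e).
by apply: (smooth_comp oU oV VU) => [k|]; [exact: sf|exact: sphi].
Qed.

Lemma smooth_fun_comp f phi : smooth_map f -> smooth_fun phi -> smooth_fun (phi
  \o f).
Proof.
move=> sf sphi c ac; apply: smooth_on_local => z cz.
pose d := chart_at (f (cinv c z)); have ad : atlas M d := chart_at_atlas _.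
exists (local_dom c d f); split.
- by apply: local_dom_open; case: sf.
- by apply/local_domP; split=> //; exact: chart_at_dom.
- exact: smooth_local_expr.
Qed.

Lemma smooth_funM phi psi : smooth_fun phi -> smooth_fun psi ->
  smooth_fun (fun x => phi x * psi x).
Proof.
by move=> sp sq c ac; apply: smoothM; [exact: cimg_open|exact: sp|exact: sq].
Qed.

Lemma smooth_funV phi : (forall x, phi x != 0) -> smooth_fun phi ->
  smooth_fun (fun x => (phi x)^-1).
Proof.
by move=> p0 sp c ac; apply: smoothV; [exact: cimg_open|move=> y _;
  exact: p0|exact: sp].
Qed.

Definition img_oset c : oset R n := OSet (@cimg_open _ _ _ c).

Section MetricChart.
Variables (g : metric M) (c : chart R n M).
Hypothesis ac : atlas M c.

Lemma comp_smooth i j : smooth_on (oset_set (img_oset c)) (fun z => g c z i j).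
Proof. exact: metric_smooth. Qed.

Lemma comp_sym z : img c z -> (g c z)^T = g c z.
Proof. by case=> x cx <-; exact: metric_sym. Qed.

Lemma comp_unit z : img c z -> g c z \in unitmx.
Proof. by case=> x cx <-; exact: metric_nondeg. Qed.

End MetricChart.

Lemma smooth_ln_chart c (q : M -> R) : atlas M c -> (forall x, 0 < q x) ->
  smooth_fun q -> smooth_on (img c) (fun z => ln (q (cinv c z))).
Proof.
move=> ac q0 sq; apply: smooth_ln; [exact: cimg_open|by move=> z _; exact: q0|].
exact: sq.
Qed.

Lemma expR_2ln (a : R) : 0 < a -> expR (2 * ln a) = a ^+ 2.
Proof. by move=> a0; rewrite mulr_natl mulr2n expRD lnK// expr2. Qed.

Lemma expR_mul_ln (a b : R) : 0 < a -> expR (b * ln a) = a `^ b.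
Proof. by move=> a0; rewrite /powR gt_eqF. Qed.

(** * Covariance, kernel and conformal group on the manifold *)

Lemma paneitz_conformal (g1 g2 : metric M) (p phi : M -> R) : (2 < n)%N ->
  smooth_fun p -> (forall x, 0 < p x) -> conformally_related g1 g2 p ->
  smooth_fun phi -> forall x,
  p x `^ ((n%:R + 4) / 2) * paneitz g1 phi x =
  paneitz g2 (fun y => p y `^ ((n%:R - 4) / 2) * phi y) x.
Proof.
move=> n2 sp p0 g12 sphi x.
rewrite /paneitz /operator_on_M; set c := chart_at x.
have ac : atlas M c := chart_at_atlas _.
have cx : cdom c x := chart_at_dom _.
have sc k : smooth_on (img c) (fun z => z 0 k) by apply: smooth_coord;
  exact: cimg_open.
have := @local_conformal R n (img_oset c) (img_oset c) (g1 c) (g2 c) id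
  (fun z => ln (p (cinv c z))) (phi \o cinv c) n2
  (comp_smooth g1 ac) (comp_sym g1 ac) (comp_unit g1 ac)
  (comp_smooth g2 ac) (comp_sym g2 ac) (comp_unit g2 ac) (fun z cz => cz) sc
  (smooth_ln_chart ac p0 sp) (sphi c ac).
have FGH z : img c z -> \matrix_(i, j) (\sum_k \sum_l
      partial i (fun y : 'rV[R]_n => y 0 k) z
      * partial j (fun y : 'rV[R]_n => y 0 l) z * g1 c z k l) =
      expR (2 * ln (p (cinv c z))) *: g2 c z.
  case=> t ct <-; rewrite cmapK// expR_2ln// -g12//.
  (* The Jacobian of the identity is the identity matrix, so a single term of the double sum
     survives. *)
  apply/matrixP=> i j; rewrite mxE.
  rewrite (bigD1 i)//= (bigD1 j)//= !partial_coord !eqxx !mul1r.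
  rewrite big1 ?addr0 => [|l lj]; last first.
    by rewrite !partial_coord [j == l]eq_sym (negPf lj) mulr0 mul0r.
  rewrite big1 ?addr0// => k ki; apply: big1 => l _.
  by rewrite partial_coord [i == k]eq_sym (negPf ki) !mul0r.
have icx : img c (c x) by exists x.
have fe : (fun z => expR ((n%:R - 4) / 2 * ln (p (cinv c z))) * (phi \o cinv c) z)
    = (fun y => p y `^ ((n%:R - 4) / 2) * phi y) \o cinv c.
  by apply/funext => z; rewrite expR_mul_ln.
by move=> /(_ FGH _ icx); rewrite fe cmapK// expR_mul_ln//.
Qed.

(** Two functions that agree on the open set are represented by the same ring element, whatever they
    are elsewhere. *)
Lemma Qop_eq (UU : oset R n) (G : 'rV[R]_n -> 'M[R]_n) (u v : 'rV[R]_n -> R) :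
  (forall i j, smooth_on (oset_set UU) (fun z => G z i j)) ->
  (forall z, oset_set UU z -> (G z)^T = G z) ->
  (forall z, oset_set UU z -> G z \in unitmx) ->
  smooth_on (oset_set UU) u -> (forall z, oset_set UU z -> u z = v z) ->
  forall y, oset_set UU y -> Qop G u y = Qop G v y.
Proof.
move=> sG yG uG su uv y Uy; have [g gE] := diffMetric_of sG yG uG.
have rv : rep v (sfun_of su : sfun_ring) by move=> z Uz; rewrite -uv// sfun_ofE.
by rewrite (rep_Qop gE (rep_sfun_of su))// (rep_Qop gE rv).
Qed.

(** With t = f^(-1)(x), the local identity is applied to the expression of [f] from the chart of t
    to the chart of x, with [g] on both sides. In dimension 4 the weight is 0, so Q of phi o f^(-1)
    at x is Q of phi at t up to a positive factor. *)
Lemma paneitz_kernel (g : metric M) (f : diffeo M) (q : M -> R) (phi : M -> R) :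
  n = 4%N -> smooth_fun q -> (forall x, 0 < q x) ->
  (forall c d x, atlas M c -> atlas M d -> cdom c x -> cdom d (f x) ->
     pullback g f c d x = q x ^+ 2 *: g c (c x)) ->
  smooth_fun phi -> (forall x, paneitz g phi x = 0) ->
  forall x, paneitz g (act f phi) x = 0.
Proof.
move=> n4 sq q0 fg sphi phi0 x.
have n2 : (2 < n)%N by rewrite n4.
pose t := dinv f x; have ft : f t = x by rewrite /t dinvK.
pose c := chart_at t; pose d := chart_at x.
have ac : atlas M c := chart_at_atlas _.
have ad : atlas M d := chart_at_atlas _.
have ct : cdom c t := chart_at_dom _.
have dx : cdom d x := chart_at_dom _.
have [cf sf] := dfun_smooth f.
have oV : open (local_dom c d f) by exact: local_dom_open.
pose VV := OSet oV.
have Vimg z : local_dom c d f z -> img c z by move=> /local_domP[].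
pose F (z : 'rV[R]_n) := d (f (cinv c z)).
have FVU z : local_dom c d f z -> img d (F z).
  by move=> /local_domP[_ dz]; exists (f (cinv c z)).
have spsi : smooth_fun (act f phi).
  by apply: (smooth_fun_comp (f := dinv f)) => //; exact: dinv_smooth.
have sG i j : smooth_on (local_dom c d f) (fun z => g c z i j).
  by apply: smooth_onS (comp_smooth g ac i j).
have FGH z : local_dom c d f z -> \matrix_(i, j) (\sum_k \sum_l
      partial i (fun y => F y 0 k) z * partial j (fun y => F y 0 l) z
      * g d (F z) k l) = expR (2 * ln (q (cinv c z))) *: g c z.
  move=> Vz; have /local_domP[cz dz] := Vz; have [ccz cE] := imgP cz.
  by have := fg c d _ ac ad ccz dz; rewrite /pullback cE expR_2ln// => <-.
have Vct : local_dom c d f (c t) by exists t => //; split=> //=; rewrite ft.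
have := @local_conformal R n (img_oset d) VV (g d) (g c) F
  (fun z => ln (q (cinv c z))) (act f phi \o cinv d) n2
  (comp_smooth g ad) (comp_sym g ad) (comp_unit g ad)
  sG (fun z Vz => comp_sym g ac (Vimg z Vz))
  (fun z Vz => comp_unit g ac (Vimg z Vz)) FVU (sf c d ac ad)
  (smooth_onS Vimg (smooth_ln_chart ac q0 sq)) (spsi d ad) FGH _ Vct.
rewrite {1}/F cmapK// ft => e.
suff : Qop (g c) (fun z => expR ((n%:R - 4) / 2 * ln (q (cinv c z)))
    * (act f phi \o cinv d) (F z)) (c t) = 0.
  rewrite -e => /eqP; rewrite mulf_eq0 => /orP[|/eqP//].
  by rewrite gt_eqF ?expR_gt0.
rewrite -[RHS](phi0 t) /paneitz /operator_on_M -/c; apply/esym.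
have sphic : smooth_on (oset_set VV) (phi \o cinv c).
  exact: smooth_onS Vimg (sphi c ac).
apply: (@Qop_eq VV _ _ _ sG _ _ sphic) => //.
- by move=> z Vz; apply: comp_sym => //; exact: Vimg.
- by move=> z Vz; apply: comp_unit => //; exact: Vimg.
move=> z /local_domP[cz dz] /=.
have n0 : n%:R - 4 = 0 :> R by apply/eqP; rewrite subr_eq0 eqr_nat; apply/eqP.
by rewrite n0 mul0r mul0r expR0 mul1r /act /F cmapK// dfunK.
Qed.

Lemma conformal_group_sub (g1 g2 : metric M) (p : M -> R) :
  smooth_fun p -> (forall x, 0 < p x) -> conformally_related g1 g2 p ->
  conformal_group g1 `<=` conformal_group g2.
Proof.
move=> sp p0 g12 f [q [sq q0 fg]].
(* From f^* g_1 = (p o f)^2 f^* g_2 and f^* g_1 = q^2 g_1 = q^2 p^2 g_2. *)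
exists (fun x => q x * p x * (p (f x))^-1); split.
- apply: smooth_funM; first exact: smooth_funM.
  apply: (smooth_funV (phi := p \o f)).
    by move=> x; rewrite gt_eqF//; exact: p0.
  by apply: smooth_fun_comp => //; exact: dfun_smooth.
- by move=> x; rewrite !mulr_gt0// invr_gt0.
move=> c d x ac ad cx dfx.
have pf0 : p (f x) != 0 by rewrite gt_eqF.
have e : pullback g1 f c d x = p (f x) ^+ 2 *: pullback g2 f c d x.
  apply/matrixP=> i j; rewrite !mxE mulr_sumr; apply: eq_bigr => k _.
  rewrite mulr_sumr; apply: eq_bigr => l _.
  by rewrite g12// mxE mulrCA.
have := fg c d x ac ad cx dfx; rewrite e g12// scalerA => e2.
rewrite -[LHS]scale1r -(mulVf (expf_neq0 2 pf0)) -scalerA e2 scalerA.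
by congr (_ *: _); rewrite !exprMn exprVn mulrC.
Qed.

Lemma conformally_related_sym (g1 g2 : metric M) (p : M -> R) :
  (forall x, 0 < p x) -> conformally_related g1 g2 p ->
  conformally_related g2 g1 (fun x => (p x)^-1).
Proof.
move=> p0 g12 c x ac cx; rewrite g12// scalerA -exprMn mulVf ?gt_eqF//.
by rewrite expr1n scale1r.
Qed.

Lemma paneitz_dim4 (g : metric M) (phi : M -> R) : n = 4%N -> smooth_fun phi ->
  forall x, paneitz g phi x = paneitz4 g phi x.
Proof.
move=> n4 sphi x; rewrite /paneitz /paneitz4 /operator_on_M; set c := chart_at x.
have ac : atlas M c := chart_at_atlas _.
have cx : img c (c x) by exists x => //; exact: chart_at_dom.
have [h hE] := diffMetric_of (comp_smooth g ac) (comp_sym g ac) (comp_unit g ac).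
have sphic : smooth_on (oset_set (img_oset c)) (phi \o cinv c) by exact: sphi.
exact: (Qop_dim4 hE (rep_sfun_of sphic)).
Qed.

End Charts.

Theorem theorem1 (R : realType) (n : nat) (n_gt2 : (2 < n)%N)
    (M : smoothManifold R n) (g1 g2 : metric M) (p : M -> R)
    (p_smooth : smooth_fun p) (p_gt0 : forall x : M, 0 < p x)
    (g1g2 : conformally_related g1 g2 p) :
  (forall phi : M -> R, smooth_fun phi -> forall x : M,
     p x `^ ((n%:R + 4) / 2) * paneitz g1 phi x =
     paneitz g2 (fun y => p y `^ ((n%:R - 4) / 2) * phi y) x) /\
  (n = 4%N ->
     [/\ forall (g : metric M) (phi : M -> R), smooth_fun phi ->
           forall x : M, paneitz g phi x = paneitz4 g phi x,
         ker_paneitz g1 = ker_paneitz g2,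
         conformal_group g1 = conformal_group g2 &
         forall f : diffeo M, conformal_group g1 f ->
           forall phi : M -> R, ker_paneitz g1 phi ->
             ker_paneitz g1 (act f phi)]).
Proof.
have main phi : smooth_fun phi -> forall x : M,
    p x `^ ((n%:R + 4) / 2) * paneitz g1 phi x =
    paneitz g2 (fun y => p y `^ ((n%:R - 4) / 2) * phi y) x.
  by move=> sphi; exact: paneitz_conformal.
split; first exact: main.
move=> n4; have n0 : n%:R - 4 = 0 :> R.
  by apply/eqP; rewrite subr_eq0 eqr_nat; apply/eqP.
split.
- by move=> g phi sphi; exact: paneitz_dim4.
(* In dimension 4 the inner power of p is 1, so the two operators differ by a positive factor and
   have the same kernel. *)
- have main4 phi : smooth_fun phi -> forall x : M,
      p x `^ ((n%:R + 4) / 2) * paneitz g1 phi x = paneitz g2 phi x.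
    move=> sphi x; rewrite main//.
    have -> : (fun y => p y `^ ((n%:R - 4) / 2) * phi y) = phi; last by [].
    by apply/funext => y; rewrite n0 mul0r powRr0 mul1r.
  apply/seteqP; split=> phi [sphi phi0]; (split; first exact: sphi) => x.
    by rewrite -main4// phi0 mulr0.
  have /eqP := main4 _ sphi x; rewrite phi0 mulf_eq0 => /orP[|/eqP//].
  by rewrite gt_eqF// powR_gt0.
- apply/seteqP; split; first exact: conformal_group_sub p_smooth p_gt0 g1g2.
  apply: (conformal_group_sub (p := fun x => (p x)^-1)).
  + by apply: smooth_funV => // x; rewrite gt_eqF.
  + by move=> x; rewrite invr_gt0.
  + exact: conformally_related_sym.
- move=> f [q [sq q0 fg]] phi [sphi phi0]; split.
    by apply: (smooth_fun_comp (f := dinv f)) => //; exact: dinv_smooth.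
  exact: (paneitz_kernel n4 sq q0 fg sphi phi0).
Qed.
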